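(* The invariant $\theta(q,E)$ distinguishes the Thistlethwaite link $T$ from the two-component unlink $U_2$: $\theta(T)\neq\theta(U_2)$ in $\mathbb{C}[q^{\pm1},E^{\pm1}]$.
   Context: The Jones polynomial $V$ is normalized as the ambient isotopy invariant of oriented links with values in $\mathbb{C}[q^{\pm1}]$ with $V(\text{unknot})=1$ and $q^{-2}V(L_+)-q^2V(L_-)=(q-q^{-1})V(L_0)$ for all oriented Conway triples (diagrams identical except near one point, where they have respectively a positive crossing, a negative crossing, and the orientation-respecting smoothing). With $t=q^2$ this is the usual Jones polynomial. $\theta=\theta(q,E)$ is the unique ambient isotopy invariant of oriented links with values in $\mathbb{C}[q^{\pm1},E^{\pm1}]$ ($q,E$ indeterminates) such that: (1) $q^{-2}\theta(L_+)-q^2\theta(L_-)=(q-q^{-1})\theta(L_0)$ for every oriented Conway triple whose distinguished crossing is between two different components; (2) $\theta(\mathcal{K})=E^{1-r}V(\mathcal{K})$ for every split union $\mathcal{K}$ of $r\ge1$ knots. The existence and uniqueness of $\theta$ may be assumed. The Thistlethwaite link $T$ is the oriented two-component link of M. Thistlethwaite (''Links with trivial Jones polynomial'', J. Knot Theory Ramifications 10 (2001)). It consists of an intertwined pair of a trefoil knot and a figure-eight knot (i.e. its two components, taken separately, are a trefoil $3_1$ and a figure-eight knot $4_1$), and its Jones polynomial equals that of the two-component unlink, $V(T)=-(q+q^{-1})=V(U_2)$. In particular its two components have linking number $0$. These facts about $T$ may be taken as its known data. *)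

(* Defs.v *)
From mathcomp Require Import all_boot all_order all_algebra.
From mathcomp Require Import fraction complex reals.
From Stdlib Require Import Relations.

Set Implicit Arguments.
Unset Strict Implicit.
Unset Printing Implicit Defensive.

Import GRing.Theory.

(** * Oriented link diagrams

    A diagram in the plane, in general position with respect to the height
    function, is cut into horizontal slices, read from bottom to top.  A slice
    [(p, e)] contains one event [e] whose leftmost strand is in position [p]
    (positions are counted from 0, from left to right); all the other strands
    are vertical.
    - [Cup o] is a local minimum, which creates two strands; the left one is
      directed upwards iff [o] holds, the right one is directed oppositely.
    - [Cap] is a local maximum, which joins two strands.
    - [Cross s] is a crossing; the over-strand is the one that goes from bottom
      left to top right iff [s] holds. *)

Inductive event : Type := Cup of bool | Cap | Cross of bool.

Definition slice : Type := (nat * event)%type.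
Definition diagram : Type := seq slice.

(** A strand between two slices is a pair [(a, o)]: [o] holds iff the strand is
    directed upwards, and the label [a] is the index of the slice containing
    the local minimum from which the strand comes. *)

Definition strand : Type := (nat * bool)%type.

Definition step (k : nat) (x : slice) (st : seq strand) : option (seq strand) :=
  let: (p, e) := x in
  match e, drop p st with
  | Cup o, r =>
      if p <= size st then Some (take p st ++ [:: (k, o), (k, ~~ o) & r])
      else None
  | Cap, [:: u, v & r] =>
      if u.2 != v.2 then Some (take p st ++ r) else None
  | Cross _, [:: u, v & r] => Some (take p st ++ [:: v, u & r])
  | _, _ => None
  end.

Fixpoint run (k : nat) (D : diagram) (st : seq strand) : option (seq strand) :=
  if D is x :: D' then obind (run k.+1 D') (step k x st) else Some st.

(** The strands at the top of [D], from left to right; [None] if [D] is not the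
    lower part of an oriented link diagram. *)
Definition strands (D : diagram) : option (seq strand) := run 0 D [::].

(** No strand is left at the top. *)
Definition is_link (D : diagram) : bool := strands D == Some [::].

Definition top_strand (D : diagram) (p : nat) : strand :=
  nth (0, true) (odflt [::] (strands D)) p.
Definition label (D : diagram) (p : nat) : nat := (top_strand D p).1.
Definition upward (D : diagram) (p : nat) : bool := (top_strand D p).2.

(** * Components *)

Definition slice_at (D : diagram) (k : nat) : slice := nth (0, Cap) D k.

Definition cups (D : diagram) : seq nat :=
  [seq k <- iota 0 (size D) | if (slice_at D k).2 is Cup _ then true else false].

(** The pairs of labels joined by the local maxima of [D]. *)
Definition joins (D : diagram) : seq (nat * nat) :=
  flatten [seq (let: (p, e) := slice_at D k in
                if e is Cap then
                  [:: (label (take k D) p, label (take k D) p.+1)]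
                else [::]) | k <- iota 0 (size D)].

(** A component is a class of labels for the equivalence relation generated by
    [joins D]; [rep D a] is the representative of the class of [a] computed by
    successive mergers. *)
Definition rep (D : diagram) : nat -> nat :=
  foldl (fun (f : nat -> nat) (ab : nat * nat) (c : nat) =>
           if f c == f ab.1 then f ab.2 else f c)
        id (joins D).

Definition components (D : diagram) : seq nat :=
  undup [seq rep D a | a <- cups D].

Definition is_knot (D : diagram) : bool :=
  is_link D && (size (components D) == 1).

(** The part of [D] formed by the strands whose labels satisfy [P]. *)
Definition sublink (P : pred nat) (D : diagram) : diagram :=
  flatten
    [seq (let: (p, e) := slice_at D k in
          let low := take k D in
          let involved :=
            if e is Cup _ then [:: k] else [:: label low p; label low p.+1] in
          if all P involved then
            [:: (count P [seq label low i | i <- iota 0 p], e)]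
          else [::]) | k <- iota 0 (size D)].

(** The component of [D] represented by [c], the others being erased. *)
Definition component (D : diagram) (c : nat) : diagram :=
  sublink [pred a | rep D a == c] D.

(** * Ambient isotopy: planar isotopy and Reidemeister moves *)

Definition width_in (e : event) : nat := if e is Cup _ then 0 else 2.
Definition width_out (e : event) : nat := if e is Cap then 0 else 2.

(** Orientations need no mention except on local minima, because a move is only
    performed between two link diagrams. *)
Inductive local_move : diagram -> diagram -> Prop :=
  (* events far apart *)
  | Exchange (p n : nat) (e e' : event) :
      local_move [:: (p, e); (p + width_out e + n, e')]
                 [:: (p + width_in e + n, e'); (p, e)]
  (* cancellation of a local minimum and a local maximum *)
  | ZigzagL (p : nat) (o : bool) : local_move [:: (p.+1, Cup o); (p, Cap)] [::]
  | ZigzagR (p : nat) (o : bool) : local_move [:: (p, Cup o); (p.+1, Cap)] [::]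
  (* a strand passing over or under a local minimum or maximum *)
  | SlideCup (p : nat) (o s : bool) :
      local_move [:: (p, Cup o); (p.+1, Cross s)]
                 [:: (p.+1, Cup o); (p, Cross (~~ s))]
  | SlideCap (p : nat) (s : bool) :
      local_move [:: (p.+1, Cross s); (p, Cap)]
                 [:: (p, Cross (~~ s)); (p.+1, Cap)]
  (* Reidemeister moves *)
  | Reidemeister1Cup (p : nat) (o s : bool) :
      local_move [:: (p, Cup o); (p, Cross s)] [:: (p, Cup (~~ o))]
  | Reidemeister1Cap (p : nat) (s : bool) :
      local_move [:: (p, Cross s); (p, Cap)] [:: (p, Cap)]
  | Reidemeister2 (p : nat) (s : bool) :
      local_move [:: (p, Cross s); (p, Cross (~~ s))] [::]
  (* the hypothesis says that one of the three strands is above the two others,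
     and one below *)
  | Reidemeister3 (p : nat) (s1 s2 s3 : bool) :
      (s1 == s3) ==> (s2 == s1) ->
      local_move [:: (p, Cross s1); (p.+1, Cross s2); (p, Cross s3)]
                 [:: (p.+1, Cross s3); (p, Cross s2); (p.+1, Cross s1)].

Inductive isotopy_move : diagram -> diagram -> Prop :=
  | IsotopyMove (low high D D' : diagram) :
      local_move D D' ->
      is_link (low ++ D ++ high) -> is_link (low ++ D' ++ high) ->
      isotopy_move (low ++ D ++ high) (low ++ D' ++ high).

Definition isotopic : diagram -> diagram -> Prop :=
  clos_refl_sym_trans _ isotopy_move.

(** Concatenation puts link diagrams on top of each other, without crossings
    between them. *)
Definition split_union (D : diagram) (Ks : seq diagram) : Prop :=
  is_link D /\ isotopic D (flatten Ks).

(** * Particular links *)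

Definition unknot : diagram := [:: (0, Cup true); (0, Cap)].

Definition unlink2 : diagram := unknot ++ unknot.

(** The closure of the braid sigma_1 ^ 3 (right-handed trefoil) or of its
    mirror image (left-handed trefoil). *)
Definition trefoil (s : bool) : diagram :=
  [:: (0, Cup true); (1, Cup true);
      (0, Cross s); (0, Cross s); (0, Cross s);
      (1, Cap); (0, Cap)].

(** The closure of the braid (sigma_1 sigma_2^-1)^2. *)
Definition figure_eight : diagram :=
  [:: (0, Cup true); (1, Cup true); (2, Cup true);
      (0, Cross true); (1, Cross false); (0, Cross true); (1, Cross false);
      (2, Cap); (1, Cap); (0, Cap)].

Definition is_trefoil (K : diagram) : Prop :=
  exists s : bool, isotopic K (trefoil s).

Definition is_figure_eight (K : diagram) : Prop := isotopic K figure_eight.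

(** * Conway triples

    The crossing inserted between [low] and [high], in position [p]. *)

Section ConwayTriple.
Variables (low : diagram) (p : nat) (high : diagram).

Let parallel : bool := upward low p == upward low p.+1.

(** The positive crossing if [b] holds, the negative one otherwise.  A crossing
    of two upward strands is positive iff the strand from bottom left to top
    right is over, and reversing one strand changes the sign. *)
Definition crossed (b : bool) : diagram :=
  low ++ (p, Cross (b == parallel)) :: high.

Definition smoothed : diagram :=
  low ++ (if parallel then [::] else [:: (p, Cap); (p, Cup (upward low p.+1))])
      ++ high.

Definition conway_triple (Lp Lm L0 : diagram) : Prop :=
  [/\ Lp = crossed true, Lm = crossed false & L0 = smoothed]
  /\ [/\ is_link Lp, is_link Lm & is_link L0].

(** Changing the crossing does not affect the components. *)
Definition mixed_crossing : bool :=
  rep (crossed true) (label low p) != rep (crossed true) (label low p.+1).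

End ConwayTriple.

(** * Invariants *)

Local Open Scope ring_scope.

Section Invariants.
Variable R : realType.

Local Notation C := R[i].

(** The field C(q, E), which contains the rings of Laurent polynomials. *)
Definition ratfun : fieldType := {fraction {poly {poly C}}}.

Definition qvar : ratfun := tofrac (('X : {poly C})%:P).
Definition Evar : ratfun := tofrac 'X.

Local Notation q := qvar.
Local Notation E := Evar.

Definition laurent_q (x : ratfun) : Prop :=
  exists (n : nat) (f : {poly C}), x = tofrac f%:P / q ^+ n.

Definition laurent_qE (x : ratfun) : Prop :=
  exists (n : nat) (f : {poly {poly C}}), x = tofrac f / (q * E) ^+ n.

Definition isotopy_invariant (f : diagram -> ratfun) : Prop :=
  forall D D' : diagram, is_link D -> is_link D' -> isotopic D D' -> f D = f D'.

Definition skein (f : diagram -> ratfun) (Lp Lm L0 : diagram) : Prop :=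
  q ^- 2 * f Lp - q ^+ 2 * f Lm = (q - q^-1) * f L0.

Record is_jones (V : diagram -> ratfun) : Prop := IsJones {
  jones_laurent : forall D, is_link D -> laurent_q (V D);
  jones_invariant : isotopy_invariant V;
  jones_unknot : V unknot = 1;
  jones_skein : forall low p high Lp Lm L0,
    conway_triple low p high Lp Lm L0 -> skein V Lp Lm L0
}.

Record is_theta (V theta : diagram -> ratfun) : Prop := IsTheta {
  theta_laurent : forall D, is_link D -> laurent_qE (theta D);
  theta_invariant : isotopy_invariant theta;
  theta_skein : forall low p high Lp Lm L0,
    conway_triple low p high Lp Lm L0 -> mixed_crossing low p high ->
    skein theta Lp Lm L0;
  theta_split : forall (D : diagram) (Ks : seq diagram),
    (0 < size Ks)%N -> all is_knot Ks -> split_union D Ks ->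
    theta D = E ^ (1 - (size Ks)%:Z) * V D
}.

End Invariants.

(* Main.v *)
Require Import Defs.
From mathcomp Require Import all_boot all_order all_algebra.
From mathcomp Require Import fraction complex reals ring.
From Stdlib Require Import Relations.

Set Implicit Arguments.
Unset Strict Implicit.
Unset Printing Implicit Defensive.

Import GRing.Theory.

(** Put [delta = V - theta]. Smoothing a crossing between the two components of
    a link gives a knot, where [delta] vanishes, so that changing such a crossing
    multiplies [delta] by a power of [q ^+ 4]. Changing these crossings until one
    component of [T] lies above the other gives a diagram which is isotopic to
    the split union of a trefoil and a figure-eight knot, and on which
    [delta = (1 - E^-1) * V]. If [theta T] were [theta unlink2], then [delta T]
    would be [(1 - E^-1) * V unlink2], hence the product of the Jones polynomials
    of the trefoil and of the figure-eight knot would be a power of [q ^+ 4]; at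
    [q = 'i] this product is [-15]. *)

(** A diagram has no third coordinate, so pulling the upper component away has to be derived from
    local moves. The device is a braid that sorts the strands by colour, the upper component going
    to the left and over the other one. Pushed down through a slice, it absorbs a mixed crossing and
    moves any other event next to strands of its own colour; it is empty at both ends of a link
    diagram, where there are no strands. Components are handled through colourings of the local
    minima, which a crossing change leaves untouched. That smoothing a mixed crossing merges the two
    components depends on the whole course of the strands; a count of the strands directed upwards
    and downwards, colour by colour, settles it. The skein axioms do not include multiplicativity of
    [V] under split union, so the product of the two polynomials is obtained from skein computations
    made with another link stacked on top. At [q = 'i] every power of [q ^+ 4] becomes 1, so it
    suffices that the product takes there a value other than 1. *)

(** * Runs of a diagram on coloured strands *)

Section Runs.
Variable X : Type.
Implicit Types (ok : rel X) (phi : nat -> X) (st : seq (X * bool)).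

(** Colours live in any type, and [ok] restricts the colours that a local maximum may join. Labels
    ([anyrel] on [nat]), colourings ([eq_op]) and mere shapes (colours in [unit]) become runs of one
    function, compared by recolouring. *)
Definition gstep ok (c : X) (x : slice) st : option (seq (X * bool)) :=
  let: (p, e) := x in
  match e, drop p st with
  | Cup o, r =>
      if p <= size st then Some (take p st ++ [:: (c, o), (c, ~~ o) & r])
      else None
  | Cap, [:: u, v & r] =>
      if ok u.1 v.1 && (u.2 != v.2) then Some (take p st ++ r) else None
  | Cross _, [:: u, v & r] => Some (take p st ++ [:: v, u & r])
  | _, _ => None
  end.

Fixpoint grun ok phi (D : diagram) st : option (seq (X * bool)) :=
  if D is x :: D' then obind (grun ok (phi \o S) D') (gstep ok (phi 0) x st)
  else Some st.

Lemma gstepS ok c p e u st :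
  gstep ok c (p.+1, e) (u :: st) = omap (cons u) (gstep ok c (p, e) st).
Proof.
case: e => [o||s] /=; first by rewrite ltnS; case: (p <= _).
- by case: (drop p st) => [|a [|b r]] //=; case: (_ && _).
- by case: (drop p st) => [|a [|b r]].
Qed.

Lemma gstep_cup0 ok c o st :
  gstep ok c (0, Cup o) st = Some [:: (c, o), (c, ~~ o) & st].
Proof. by rewrite /gstep take0 drop0. Qed.

Lemma gstep_cap0 ok c u v st :
  gstep ok c (0, Cap) [:: u, v & st]
  = if ok u.1 v.1 && (u.2 != v.2) then Some st else None.
Proof. by []. Qed.

Lemma gstep_cross0 ok c s u v st :
  gstep ok c (0, Cross s) [:: u, v & st] = Some [:: v, u & st].
Proof. by []. Qed.

Lemma gstepS_nil ok c p e : gstep ok c (p.+1, e) [::] = None.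
Proof. by case: e. Qed.

Lemma gstep_size_cat ok c e A st :
  gstep ok c (size A, e) (A ++ st) = omap (cat A) (gstep ok c (0, e) st).
Proof.
elim: A => [|u A IH]; first by rewrite cat0s; case: (gstep _ _ _ _).
by rewrite cat_cons gstepS IH; case: (gstep _ _ _ _).
Qed.

Lemma grun_cat ok phi A B st :
  grun ok phi (A ++ B) st
  = obind (grun ok (fun j => phi (size A + j)) B) (grun ok phi A st).
Proof.
elim: A phi st => [|x A IH] phi st //=.
by case: (gstep _ _ _ _) => //= st'; rewrite IH.
Qed.

Lemma eq_grun ok phi psi D st :
  (forall k, (if (slice_at D k).2 is Cup _ then true else false) ->
     phi k = psi k) ->
  grun ok phi D st = grun ok psi D st.
Proof.
elim: D phi psi st => [|x D IH] phi psi st eqf //=.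
have -> : gstep ok (phi 0) x st = gstep ok (psi 0) x st.
  by case: x eqf => p [] //= o eqf; rewrite (eqf 0).
by case: (gstep _ _ _ _) => //= st'; apply: IH => k; apply: (eqf k.+1).
Qed.

Lemma grun_sub ok ok' phi D st st' : subrel ok ok' ->
  grun ok phi D st = Some st' -> grun ok' phi D st = Some st'.
Proof.
move=> sub; elim: D phi st => [|x D IH] phi st //=.
have step_sub t : gstep ok (phi 0) x st = Some t ->
    gstep ok' (phi 0) x st = Some t.
  case: x => p [] //=; case: (drop p st) => [|a [|b r]] //=.
  by case: (boolP (ok _ _)) => //= /sub ->.
case E: (gstep ok (phi 0) x st) => [t|] //= H.
by rewrite (step_sub _ E); apply: IH.
Qed.

Lemma grun_and ok1 ok2 phi D st t1 t2 :
  grun ok1 phi D st = Some t1 -> grun ok2 phi D st = Some t2 ->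
  grun (fun x y => ok1 x y && ok2 x y) phi D st = Some t1.
Proof.
elim: D phi st => [|[p e] D IH] phi st //=.
case: e => [o||s] /=.
- by case: ifP => //= _; apply: IH.
- case: (drop p st) => [|a [|b r]] //=.
  case: (ok1 _ _) => //=; case: (a.2 != b.2); rewrite ?andbF ?andbT //=.
  by case: (ok2 _ _) => //=; apply: IH.
- by case: (drop p st) => [|a [|b r]] //=; apply: IH.
Qed.
End Runs.
Arguments gstep : simpl never.

Definition recolor (X Y : Type) (f : X -> Y) (st : seq (X * bool)) :=
  [seq (f u.1, u.2) | u <- st].

Lemma gstep_recolor (X Y : Type) (f : X -> Y) (ok : rel Y) c x st :
  gstep ok (f c) x (recolor f st)
  = omap (recolor f) (gstep (relpre f ok) c x st).
Proof.
case: x => p e; rewrite /gstep -map_drop -map_take size_map.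
case: e => [o||s].
- by case: ifP => //= _; rewrite /recolor map_cat /=.
- case: (drop p st) => [|a [|b r]] //=.
  by case: ifP => //= _; rewrite /recolor map_cat.
- by case: (drop p st) => [|a [|b r]] //=; rewrite /recolor map_cat.
Qed.

(** Naturality in the colours, the test being pulled back along [f]. With [phi] the identity, it
    makes every coloured run the image of the run on labels. *)
Lemma grun_recolor (X Y : Type) (f : X -> Y) (ok : rel Y) phi D st :
  grun ok (f \o phi) D (recolor f st)
  = omap (recolor f) (grun (relpre f ok) phi D st).
Proof.
elim: D phi st => [|x D IH] phi st //=; rewrite gstep_recolor.
by case: (gstep _ _ _ _) => [t|] //=; rewrite -IH.
Qed.

Lemma recolor_comp (X Y Z : Type) (f : X -> Y) (g : Y -> Z) st :
  recolor g (recolor f st) = recolor (g \o f) st.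
Proof. by rewrite /recolor -map_comp. Qed.

(** * Tangles and safe moves *)

Definition anyrel (X : Type) : rel X := fun _ _ => true.

Definition urun (D : diagram) (s : seq (unit * bool)) :=
  grun (@anyrel unit) (fun _ => tt) D s.

Lemma urun_cat A B s : urun (A ++ B) s = obind (urun B) (urun A s).
Proof. exact: grun_cat. Qed.

Definition forget_color (X : Type) : seq (X * bool) -> seq (unit * bool) :=
  recolor (fun _ => tt).

Lemma urun_grun (X : Type) (phi : nat -> X) D st :
  urun D (forget_color st) = omap (@forget_color X) (grun (@anyrel X) phi D st).
Proof. exact: (grun_recolor (fun _ : X => tt) (@anyrel unit) phi). Qed.

Lemma grun_urun (X : Type) (ok : rel X) (phi : nat -> X) D st st' :
  grun ok phi D st = Some st' ->
  urun D (forget_color st) = Some (forget_color st').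
Proof.
move=> H; rewrite (urun_grun phi).
by rewrite (grun_sub (ok' := @anyrel X) _ H).
Qed.

Lemma run_grun k D (st : seq strand) :
  run k D st = grun (@anyrel nat) (addn k) D st.
Proof.
elim: D k st => [|x D IH] k st //.
rewrite [LHS]/= [RHS]/=.
have -> : step k x st = gstep (@anyrel nat) (k + 0) x st.
  by case: x => p []; rewrite addn0.
case: (gstep _ _ _ _) => [t|] //=; rewrite IH.
by apply: eq_grun => j _ /=; rewrite addSnnS.
Qed.

Lemma strands_grun D : strands D = grun (@anyrel nat) id D [::].
Proof. by rewrite /strands run_grun; apply: eq_grun. Qed.

Lemma is_linkE D : is_link D = (urun D [::] == Some [::]).
Proof.
rewrite /is_link strands_grun (urun_grun id D [::]).
by case: (grun _ _ _ _) => [[|? ?]|].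
Qed.

Lemma is_linkP D : reflect (urun D [::] = Some [::]) (is_link D).
Proof. by rewrite is_linkE; apply: eqP. Qed.

Lemma is_link_cat A B : is_link A -> is_link B -> is_link (A ++ B).
Proof. by move=> /is_linkP hA /is_linkP hB; apply/is_linkP; rewrite urun_cat hA. Qed.

Definition shift (n : nat) (D : diagram) : diagram :=
  [seq (n + x.1, x.2) | x <- D].

Lemma shift_cat n A B : shift n (A ++ B) = shift n A ++ shift n B.
Proof. exact: map_cat. Qed.

Lemma shift_shift m n A : shift m (shift n A) = shift (m + n) A.
Proof. by rewrite /shift -map_comp; apply: eq_map => x /=; rewrite addnA. Qed.

Lemma shift0 A : shift 0 A = A.
Proof. by rewrite /shift -[RHS]map_id; apply: eq_map => -[]. Qed.

Lemma urun_shift1 D u s : urun (shift 1 D) (u :: s) = omap (cons u) (urun D s).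
Proof.
elim: D s => [|[p e] D IH] s //.
rewrite /urun /= -/(shift 1 D) gstepS.
by case: (gstep _ _ _ _) => //= t; apply: IH.
Qed.

Lemma urun_shift1_nil D : D <> [::] -> urun (shift 1 D) [::] = None.
Proof. by case: D => // -[p e] D _; rewrite /urun /= gstepS_nil. Qed.

(** The empty diagram runs on any strands, whereas a bigon needs two of them and a zigzag one with
    the right direction; hence a one-sided condition when [B] is empty. Since [A] is not empty,
    [shift 1 A] fails when there is no strand, which makes the notion stable under shifts. *)
Definition compatible (A B : diagram) :=
  A <> [::] /\
  if B is [::] then forall s t, urun A s = Some t -> t = s
  else forall s, urun A s = urun B s.

Lemma compatible_shift1 A B :
  compatible A B -> compatible (shift 1 A) (shift 1 B).
Proof.
case=> nA H; split; first by case: A nA H => [/(_ erefl)|].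
case: B H => [|x B] H.
  case=> [|u s] t; first by rewrite urun_shift1_nil.
  by rewrite urun_shift1; case E: (urun A s) => //= -[<-]; rewrite (H _ _ E).
change (forall s, urun (shift 1 A) s = urun (shift 1 (x :: B)) s).
by case=> [|u s]; rewrite ?urun_shift1_nil // !urun_shift1 H.
Qed.

Lemma compatible_shift n A B : compatible A B -> compatible (shift n A) (shift n B).
Proof.
elim: n => [|n IH] H; first by rewrite !shift0.
by rewrite -add1n -!shift_shift; apply/compatible_shift1/IH.
Qed.

Lemma local_move_shift n A B :
  local_move A B -> local_move (shift n A) (shift n B).
Proof.
case=> *; rewrite /shift /= ?addnA ?addnS.
- exact: Exchange.
- exact: ZigzagL.
- exact: ZigzagR.
- exact: SlideCup.
- exact: SlideCap.
- exact: Reidemeister1Cup.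
- exact: Reidemeister1Cap.
- exact: Reidemeister2.
- exact: Reidemeister3.
Qed.

Lemma local_move_compatible A B : local_move A B -> compatible A B.
Proof.
(* Every move is a translate of the same move at position 0, where the runs can be computed. *)
have sh p A0 B0 A1 B1 : compatible A0 B0 ->
    A1 = shift p A0 -> B1 = shift p B0 -> compatible A1 B1.
  by move=> + -> ->; apply: compatible_shift.
case=> [p n e e'|p o|p o|p o s|p s|p o s|p s|p s|p s1 s2 s3 _].
- apply: (@sh p [:: (0, e); (width_out e + n, e')] [:: (width_in e + n, e'); (0, e)]);
    rewrite /shift /= ?addn0 ?addnA //.
  split=> // s; rewrite /urun /=.
  case: e => [o||b]; rewrite ?add2n ?add0n.
  + rewrite gstep_cup0 /= !gstepS.
    by case: (gstep _ _ _ _) => //= t; rewrite take0 drop0.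
  + case: s => [|u [|v s]]; rewrite ?gstepS ?gstepS_nil //.
    rewrite gstep_cap0; case: ifP => /= E; case: (gstep _ _ _ _) => //= t;
      by rewrite gstep_cap0 E.
  + case: s => [|u [|v s]]; rewrite ?gstepS ?gstepS_nil //.
    rewrite gstep_cross0 /= !gstepS.
    by case: (gstep _ _ _ _).
- apply: (@sh p [:: (1, Cup o); (0, Cap)] [::]); rewrite /shift /= ?addn0 ?addn1 //.
  split=> //= -[|u s] t //; rewrite /urun /= /gstep /= ?take0 ?drop0 /=.
  by case: u => -[] b /=; case: o; case: b => //= -[<-].
- apply: (@sh p [:: (0, Cup o); (1, Cap)] [::]); rewrite /shift /= ?addn0 ?addn1 //.
  split=> //= -[|u s] t //; rewrite /urun /= /gstep /= ?take0 ?drop0 /=.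
  by case: u => -[] b /=; case: o; case: b => //= -[<-].
- apply: (@sh p [:: (0, Cup o); (1, Cross s)] [:: (1, Cup o); (0, Cross (~~ s))]);
    rewrite /shift /= ?addn0 ?addn1 //.
  by split=> //= -[|u t] //; rewrite /urun /= /gstep /= ?take0 ?drop0.
- apply: (@sh p [:: (1, Cross s); (0, Cap)] [:: (0, Cross (~~ s)); (1, Cap)]);
    rewrite /shift /= ?addn0 ?addn1 //.
  by split=> //= -[|u [|v [|w t]]] //; rewrite /urun /= /gstep /= ?take0 ?drop0 //=; case: ifP.
- apply: (@sh p [:: (0, Cup o); (0, Cross s)] [:: (0, Cup (~~ o))]);
    rewrite /shift /= ?addn0 ?addn1 //.
  by split=> //= t; rewrite /urun /= /gstep /= ?take0 ?drop0 /= negbK.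
- apply: (@sh p [:: (0, Cross s); (0, Cap)] [:: (0, Cap)]);
    rewrite /shift /= ?addn0 ?addn1 //.
  by split=> //= -[|u [|v t]] //; rewrite /urun /= /gstep /= ?take0 ?drop0 //= eq_sym.
- apply: (@sh p [:: (0, Cross s); (0, Cross (~~ s))] [::]);
    rewrite /shift /= ?addn0 ?addn1 //.
  by split=> //= -[|u [|v r]] t //; rewrite /urun /= /gstep /= ?take0 ?drop0 //= => -[].
- apply: (@sh p [:: (0, Cross s1); (1, Cross s2); (0, Cross s3)]
     [:: (1, Cross s3); (0, Cross s2); (1, Cross s1)]);
    rewrite /shift /= ?addn0 ?addn1 //.
  by split=> //= -[|u [|v [|w t]]] //; rewrite /urun /= /gstep /= ?take0 ?drop0.
Qed.

(* The reversed moves that create a zigzag or a bigon out of nothing are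
   excluded, because they may take a link diagram to an ill-formed one. *)
Definition safe_move (A B : diagram) :=
  local_move A B \/ (local_move B A /\ A <> [::]).

Inductive red : diagram -> diagram -> Prop :=
  | red_refl A : red A A
  | red_trans A B C : red A B -> red B C -> red A C
  | red_move low high A B : safe_move A B -> red (low ++ A ++ high) (low ++ B ++ high).

Lemma safe_move_urun A B s t :
  safe_move A B -> urun A s = Some t -> urun B s = Some t.
Proof.
case=> [/local_move_compatible[_]|[/local_move_compatible[_] + nA]].
- by case: B => [H /H ->|x B ->].
- by case: A nA => // x A _ <-.
Qed.

Lemma red_urun A B s t : red A B -> urun A s = Some t -> urun B s = Some t.
Proof.
move=> rAB; elim: rAB s t => {A B} // [A B C _ IH1 _ IH2 s t /IH1/IH2 //|].
move=> low high A B m s t; rewrite !urun_cat; case: (urun low s) => //= s1.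
rewrite !urun_cat; case E: (urun A s1) => [s2|] //=.
by rewrite (safe_move_urun m E).
Qed.

Lemma red_shift n A B : red A B -> red (shift n A) (shift n B).
Proof.
elim=> [{}A|{}A {}B C _ + _|low high {}A {}B m]; first exact: red_refl.
  exact: red_trans.
rewrite !shift_cat; apply: red_move.
case: m => [/(local_move_shift n)|[/(local_move_shift n) m nA]]; first by left.
by right; split=> //; case: A nA {m}.
Qed.

Lemma red_ctx low high A B : red A B -> red (low ++ A ++ high) (low ++ B ++ high).
Proof.
elim=> [{}A|{}A {}B C _ + _|low' high' {}A {}B m]; first exact: red_refl.
  exact: red_trans.
rewrite -!catA !(catA low) [B ++ _]catA -[(B ++ _) ++ _]catA; exact: red_move.
Qed.

(** Safe moves preserve runs, so the link conditions of [isotopy_move] only have to be checked at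
    the start of a reduction. *)
Lemma red_isotopic A B : is_link A -> red A B -> isotopic A B /\ is_link B.
Proof.
move=> lA rAB; elim: rAB lA => {A B} [A lA|A B C _ IH1 _ IH2 /IH1[i1 /IH2[i2 lC]]|].
- by split=> //; apply: rst_refl.
- by split=> //; apply: rst_trans i1 i2.
- move=> low high A B m lA.
  have lB : is_link (low ++ B ++ high).
    by apply/is_linkP; apply: red_urun (red_move _ _ m) (is_linkP _ lA).
  split=> //; case: m => [m|[m _]]; first by apply/rst_step/IsotopyMove.
  by apply/rst_sym/rst_step/IsotopyMove.
Qed.

Definition redd (b : bool) (A B : diagram) := if b then red A B else red B A.

Lemma redd_refl b A : redd b A A.
Proof. by case: b; apply: red_refl. Qed.

Lemma redd_trans b B A C : redd b A B -> redd b B C -> redd b A C.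
Proof. by case: b => [|/[swap]]; apply: red_trans. Qed.

Lemma redd_shift b n A B : redd b A B -> redd b (shift n A) (shift n B).
Proof. by case: b; apply: red_shift. Qed.

Lemma redd_catl b L A B : redd b A B -> redd b (L ++ A) (L ++ B).
Proof.
by case: b => /(red_ctx L [::]); rewrite !cats0.
Qed.

Lemma redd_catr b L A B : redd b A B -> redd b (A ++ L) (B ++ L).
Proof. by case: b => /(red_ctx [::] L). Qed.

Lemma redd_local b A B : local_move A B -> B <> [::] -> redd b A B /\ redd b B A.
Proof.
move=> m nB; have AB : red A B.
  by have:= @red_move [::] [::] A B (or_introl m); rewrite /= !cats0.
have BA : red B A.
  by have:= @red_move [::] [::] B A (or_intror (conj m nB)); rewrite /= !cats0.
by case: b.
Qed.

Lemma red_local A B : local_move A B -> red A B.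
Proof.
by move=> m; have:= @red_move [::] [::] A B (or_introl m); rewrite /= !cats0.
Qed.

Lemma redd_comm0 b e D :
  redd b ((0, e) :: shift (width_out e) D) (shift (width_in e) D ++ [:: (0, e)]).
Proof.
elim: D => [|[n e'] D IH]; first exact: redd_refl.
apply: (@redd_trans b ((width_in e + n, e') :: (0, e) :: shift (width_out e) D)).
  apply: (@redd_catr b (shift (width_out e) D) [:: _; _] [:: _; _]).
  by case: (redd_local b (Exchange 0 n e e')).
exact: (@redd_catl b [:: _]).
Qed.

(** * Separating two colours of strands *)

(* A strand crosses, from left to right, under [k] others. *)
Fixpoint pass (k : nat) : diagram :=
  if k is k'.+1 then (0, Cross false) :: shift 1 (pass k') else [::].

(* Moves the strands of colour [true] to the left, above the others. *)
Fixpoint sortb (w : seq bool) : diagram :=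
  if w is c :: w' then
    shift 1 (sortb w') ++ (if c then [::] else pass (count id w'))
  else [::].

(* Bigons and zigzags can only be removed by [red]: across a local maximum, the
   moves are read backwards. *)
Definition dir (e : event) : bool := if e is Cap then false else true.

Lemma pass_high b k j e :
  redd b ((k.+1 + j, e) :: pass k) (pass k ++ [:: (k.+1 + j, e)]).
Proof.
elim: k => [|k IH]; first exact: redd_refl.
apply: (@redd_trans b ((0, Cross false) :: shift 1 ((k.+1 + j, e) :: pass k))).
  apply: (@redd_catr b (shift 1 (pass k)) [:: _; _] [:: _; _]).
  by case: (redd_local b (Exchange 0 (k + j) (Cross false) e)).
apply: (redd_catl [:: _]).
by have:= redd_shift 1 IH; rewrite shift_cat /= add1n !addSn.
Qed.

(** The leftmost strand passes under the two strands of an event; as widths, only [n = 0] and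
    [n = 2] occur. *)
Definition under2 (n : nat) : diagram :=
  if n is 0 then [::] else [:: (0, Cross false); (1, Cross false)].

(** For a local minimum or maximum, a slide produces a bigon, which is then removed; for a crossing
    this is the third Reidemeister move with the passing strand at the bottom. *)
Lemma under2_event e :
  redd (dir e) ((1, e) :: under2 (width_out e)) (under2 (width_in e) ++ [:: (0, e)]).
Proof.
case: e => [o||s] /=.
- apply: (red_trans (B := [:: (0, Cup o); (1, Cross true); (1, Cross false)])).
    apply: (red_ctx [::] [:: (1, Cross false)] (A := [:: _; _]) (B := [:: _; _])).
    by case: (redd_local true (SlideCup 0 o true)).
  apply: (red_ctx [:: _] [::] (A := [:: _; _]) (B := [::])).
  exact: (red_local (Reidemeister2 1 true)).
- apply: (red_trans (B := [:: (0, Cross false); (0, Cross true); (1, Cap)])).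
    apply: (red_ctx [:: _] [::] (A := [:: _; _]) (B := [:: _; _])).
    by case: (redd_local true (SlideCap 0 false)).
  apply: (red_ctx [::] [:: _] (A := [:: _; _]) (B := [::])).
  exact: (red_local (Reidemeister2 0 false)).
- have [] // := @redd_local true _ _ (@Reidemeister3 0 false false s _).
  by case: s.
Qed.

(** Here a strand comes from the right over the two strands of an event: it is one of the strands
    under which a cable passes. *)
Definition over2 (n : nat) : diagram :=
  if n is 0 then [::] else [:: (1, Cross false); (0, Cross false)].

Lemma over2_event e :
  redd (dir e) ((0, e) :: over2 (width_out e)) (over2 (width_in e) ++ [:: (1, e)]).
Proof.
case: e => [o||s] /=.
- apply: (red_trans (B := [:: (1, Cup o); (0, Cross true); (0, Cross false)])).
    apply: (red_ctx [::] [:: (0, Cross false)] (A := [:: _; _]) (B := [:: _; _])).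
    by case: (redd_local true (SlideCup 0 o false)).
  apply: (red_ctx [:: _] [::] (A := [:: _; _]) (B := [::])).
  exact: (red_local (Reidemeister2 0 true)).
- apply: (red_trans (B := [:: (1, Cross false); (1, Cross true); (0, Cap)])).
    apply: (red_ctx [:: _] [::] (A := [:: _; _]) (B := [:: _; _])).
    by case: (redd_local true (SlideCap 0 true)).
  apply: (red_ctx [::] [:: _] (A := [:: _; _]) (B := [::])).
  exact: (red_local (Reidemeister2 1 false)).
- have [] // := @redd_local true _ _ (@Reidemeister3 0 s false false _).
  by case: s.
Qed.

Lemma pass_width_out e m :
  pass (width_out e + m) = under2 (width_out e) ++ shift (width_out e) (pass m).
Proof. by case: e => [o||s] //=; rewrite ?shift0 ?add2n //= shift_shift. Qed.

Lemma pass_width_in e m :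
  pass (width_in e + m) = under2 (width_in e) ++ shift (width_in e) (pass m).
Proof. by case: e => [o||s] //=; rewrite ?shift0 ?add2n //= shift_shift. Qed.

(** The first [j] crossings are far from the event and are exchanged with it; the next ones carry
    the passing strand under the event itself. *)
Lemma pass_event e j m :
  redd (dir e) ((j.+1, e) :: pass (j + (width_out e + m)))
               (pass (j + (width_in e + m)) ++ [:: (j, e)]).
Proof.
elim: j => [|j IH].
  rewrite !add0n pass_width_out pass_width_in.
  apply: (redd_trans (B := under2 (width_in e) ++ (0, e) :: shift (width_out e) (pass m))).
    have:= redd_catr (shift (width_out e) (pass m)) (under2_event e).
    by rewrite /= -catA.
  rewrite -catA; apply: redd_catl; exact: redd_comm0.
rewrite !addSn /=.
apply: (redd_trans (B := (0, Cross false) :: shift 1 ((j.+1, e) :: pass (j + (width_out e + m))))).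
  apply: (@redd_catr _ (shift 1 _) [:: _; _] [:: _; _]).
  by case: (redd_local (dir e) (Exchange 0 j (Cross false) e)).
apply: (redd_catl [:: _]).
by have:= redd_shift 1 IH; rewrite shift_cat /= add1n.
Qed.

(** For [n = 2], two parallel strands pass under [k] others, the right one first. *)
Definition cable (n k : nat) : diagram :=
  if n is 0 then [::] else shift 1 (pass k) ++ pass k.

Lemma cableS b n k :
  redd b (cable n k.+1) (over2 n ++ shift 1 (cable n k)) /\
  redd b (over2 n ++ shift 1 (cable n k)) (cable n k.+1).
Proof.
case: n => [|n] /=; first by split; apply: redd_refl.
rewrite shift_cat !shift_shift.
suff H b' : redd b' ((0, Cross false) :: shift 2 (pass k)  ++ shift 1 (pass k))
   (shift 2 (pass k) ++ (0, Cross false) :: shift 1 (pass k)).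
  split; last exact: (@redd_catl b [:: _] _ _ (H b)).
  by have:= @redd_catl (~~ b) [:: (1, Cross false)] _ _ (H (~~ b)); case: (b).
have:= redd_catr (shift 1 (pass k)) (redd_comm0 b' (Cross false) (pass k)).
by rewrite -catA.
Qed.

(** Induction on the strands lying over the cable: [cableS] isolates one of them, and [over2_event]
    slides it over the event. *)
Lemma cable_event e k :
  redd (dir e) ((0, e) :: cable (width_out e) k) (cable (width_in e) k ++ [:: (k, e)]).
Proof.
elim: k => [|k IH]; first by case: e => [o||s]; apply: redd_refl.
have [H _] := cableS (dir e) (width_out e) k.
apply: (redd_trans (redd_catl [:: _] H)).
have [_ H'] := cableS (dir e) (width_in e) k.
apply: redd_trans (redd_catr _ H').
rewrite -catA catA; apply: (redd_trans (redd_catr _ (over2_event e))).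
rewrite -catA; apply: redd_catl.
by have:= redd_shift 1 IH; rewrite shift_cat /= add1n.
Qed.

Lemma sortb_true e w :
  (sortb (nseq (width_out e) true ++ w) = shift (width_out e) (sortb w)) *
  (sortb (nseq (width_in e) true ++ w) = shift (width_in e) (sortb w)).
Proof. by case: e => [o||s]; split; rewrite /= ?cats0 ?shift0 ?shift_shift. Qed.

Lemma sortb_false e w :
  (sortb (nseq (width_out e) false ++ w)
    = shift (width_out e) (sortb w) ++ cable (width_out e) (count id w)) *
  (sortb (nseq (width_in e) false ++ w)
    = shift (width_in e) (sortb w) ++ cable (width_in e) (count id w)).
Proof.
by case: e => [o||s]; split; rewrite /= ?cats0 ?shift0 ?shift_cat ?shift_shift ?catA.
Qed.

Lemma count_nseq_out (e : event) c :
  (count id (nseq (width_out e) c) = width_out e * c) *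
  (count id (nseq (width_in e) c) = width_in e * c).
Proof. by rewrite !count_nseq /= !(mulnC c). Qed.

Definition sorted_pos (c : bool) (w1 w2 : seq bool) : nat :=
  if c then count id w1 else count id (w1 ++ w2) + count negb w1.

(** Induction on the strands to the left of the event. One of colour [true] only shifts everything.
    One of colour [false] has to pass under all later strands of colour [true]: if [c] holds it goes
    under the event, otherwise the sorted event lies beyond the strands that it passes. *)
Lemma sortb_event e c w1 w2 :
  redd (dir e) ((size w1, e) :: sortb (w1 ++ nseq (width_out e) c ++ w2))
    (sortb (w1 ++ nseq (width_in e) c ++ w2) ++ [:: (sorted_pos c w1 w2, e)]).
Proof.
elim: w1 => [|a w1 IH].
  rewrite /sorted_pos; case: c; rewrite !cat0s.
    rewrite !sortb_true; exact: redd_comm0.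
  rewrite !sortb_false addn0 -cat_cons -catA.
  apply: (redd_trans (redd_catr _ (redd_comm0 _ e _))); rewrite -catA.
  exact: redd_catl (cable_event e (count id w2)).
have := redd_shift 1 IH; rewrite shift_cat.
set U := sortb (w1 ++ nseq (width_out e) c ++ w2).
set W := sortb (w1 ++ nseq (width_in e) c ++ w2).
rewrite /= add1n -/(shift 1 U) => {}IH.
case: a => /=; rewrite -/U -/W.
  rewrite !cats0.
  suff -> : sorted_pos c (true :: w1) w2 = 1 + sorted_pos c w1 w2 by [].
  by rewrite /sorted_pos; case: (c).
apply: (redd_trans (redd_catr _ IH)); rewrite -!catA; apply: redd_catl => /=.
rewrite add1n !count_cat !count_nseq_out /sorted_pos; case: (c) => /=.
  by rewrite !muln1; apply: pass_event.
rewrite !muln0 !add0n -count_cat add1n addnS.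
exact: pass_high.
Qed.

(** The over-strand of [Cross c] has colour [true] in both cases. If [c] holds, the sorting crosses
    the two strands back and a bigon disappears; otherwise the crossing is one that the sorting
    braid contains anyway, up to exchanges. *)
Lemma sortb_mixed c w1 w2 :
  red ((size w1, Cross c) :: sortb (w1 ++ [:: ~~ c, c & w2]))
      (sortb (w1 ++ [:: c, ~~ c & w2])).
Proof.
elim: w1 => [|a w1 IH].
  have H := redd_comm0 true (Cross c) (sortb w2); rewrite /= in H.
  case: c H => /= H.
    rewrite ?add1n !cats0 ?shift_cat !shift_shift.
    apply: red_trans (redd_catr (b := true) (pass (count id w2).+1) H) _.
    rewrite -catA; apply: (@redd_catl true).
    exact: (redd_catr (b := true) _ (red_local (Reidemeister2 0 true))).
  rewrite ?add0n !cats0 shift_cat !shift_shift.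
  have := redd_catr (b := true) (shift 1 (pass (count id w2))) H.
  by rewrite -catA.
have := red_ctx [::] (if a then [::] else pass (count id (w1 ++ [:: c, ~~ c & w2])))
   (red_shift 1 IH).
rewrite /=.
suff -> : count id (w1 ++ [:: c, ~~ c & w2]) = count id (w1 ++ [:: ~~ c, c & w2]) by [].
by rewrite !count_cat /=; case: c {IH}.
Qed.

Lemma urun_pass d a s : urun (pass (size a)) (d :: a ++ s) = Some (a ++ d :: s).
Proof.
elim: a => [|u a IH] //.
rewrite -[pass _]/([:: (0, Cross false)] ++ shift 1 (pass (size a))) urun_cat.
have -> : urun [:: (0, Cross false)] [:: d, u & a ++ s] = Some [:: u, d & a ++ s].
  by [].
by rewrite [LHS]urun_shift1 IH.
Qed.

Definition sort_strands (X : Type) (P : pred X) (st : seq (X * bool)) :=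
  [seq u <- st | P u.1] ++ [seq u <- st | ~~ P u.1].

Lemma urun_sortb (st : seq (bool * bool)) :
  urun (sortb (unzip1 st)) (forget_color st)
  = Some (forget_color (sort_strands id st)).
Proof.
rewrite /sort_strands; elim: st => [|[c d] st IH] //.
rewrite [unzip1 _]/= [sortb _]/= urun_cat.
rewrite -[forget_color (_ :: st)]/((tt, d) :: forget_color st) urun_shift1 IH.
case: c => //=.
have -> : count id (unzip1 st) = size (forget_color [seq u <- st | u.1]).
  by rewrite size_map size_filter count_map.
by rewrite /forget_color /recolor !map_cat urun_pass.
Qed.

(** * Sweeping a two-coloured diagram and separating its colours *)

Section Traverse.
Variables X Z : Type.
Implicit Types (F : X -> slice -> seq (X * bool) -> seq Z) (phi : nat -> X).

Fixpoint traverse F phi (D : diagram) (st : seq (X * bool)) : seq Z :=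
  if D is x :: D' then
    F (phi 0) x st
    ++ traverse F (phi \o S) D' (odflt [::] (gstep (@anyrel X) (phi 0) x st))
  else [::].
End Traverse.

Definition scol (X : Type) (x0 : X) (st : seq (X * bool)) (p : nat) : X :=
  (nth (x0, true) st p).1.

Definition touched (X : Type) (x0 c : X) (x : slice) st : seq X :=
  if x.2 is Cup _ then [:: c] else [:: scol x0 st x.1; scol x0 st x.1.+1].

Definition sub_slice (X : Type) (P : pred X) (x0 c : X) (x : slice) st : diagram :=
  if all P (touched x0 c x st) then
    [:: (count P [seq scol x0 st i | i <- iota 0 x.1], x.2)]
  else [::].

(** [Cross a] puts the bottom left strand over exactly when its colour [a] is [true]; at a mixed
    crossing the strand of colour [true] is therefore always over. *)
Definition over_slice (c : bool) (x : slice) (st : seq (bool * bool)) : diagram :=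
  [:: if x.2 is Cross s then
        let a := scol false st x.1 in
        (x.1, Cross (if a == scol false st x.1.+1 then s else a))
      else x].

(** What is left of a slice once the sorting braid has been pushed below it: a mixed crossing is
    absorbed, and any other event takes its position among the sorted strands. *)
Definition sep_slice (c : bool) (x : slice) (st : seq (bool * bool)) : diagram :=
  let t := touched false c x st in
  let a := head false t in
  if all (pred1 a) t then
    [:: (sorted_pos a (unzip1 (take x.1 st)) (unzip1 (drop (x.1 + width_in x.2) st)),
         x.2)]
  else [::].

(** When local maxima join equal colours, only a crossing can involve two colours. A local minimum
    has no strand below it, so its colour is tied to [c] separately. *)
Variant colored_slice (c : bool) :
    slice -> seq (bool * bool) -> seq (bool * bool) -> Prop :=
  | PureSlice a e s1 mid mid' s2 :
      unzip1 mid = nseq (width_in e) a -> unzip1 mid' = nseq (width_out e) a ->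
      (if e is Cup _ then a = c else True) ->
      (forall r, urun [:: (0, e)] (forget_color mid ++ r)
                 = Some (forget_color mid' ++ r)) ->
      colored_slice c (size s1, e) (s1 ++ mid ++ s2) (s1 ++ mid' ++ s2)
  | MixedSlice a s s1 d d' s2 :
      colored_slice c (size s1, Cross s) (s1 ++ [:: (a, d), (~~ a, d') & s2])
                    (s1 ++ [:: (~~ a, d'), (a, d) & s2]).

Lemma colored_sliceP c x st st1 :
  gstep eq_op c x st = Some st1 -> colored_slice c x st st1.
Proof.
case: x => p e; rewrite /gstep; case: e => [o||s].
- case: leqP => // le_p [<-].
  have := @PureSlice c c (Cup o) (take p st) [::] [:: (c, o); (c, ~~ o)] (drop p st).
  rewrite size_takel // cat0s cat_take_drop; apply=> // r.
  by rewrite /urun /= /gstep take0 drop0.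
- have:= cat_take_drop p st; case E: (drop p st) => [|[a d] [|[b d'] r]] //= st_eq.
  case: ifP => // /andP[/eqP/= ab dd'] [<-].
  have sp : size (take p st) = p.
    by rewrite size_takel //; apply: ltnW; rewrite -subn_gt0 -size_drop E.
  have := @PureSlice c b Cap (take p st) [:: (b, d); (b, d')] [::] r.
  rewrite ab in st_eq; rewrite sp [_ ++ _ ++ _]st_eq; apply=> // r'.
  by rewrite /urun /= /gstep /= dd'.
- have:= cat_take_drop p st; case E: (drop p st) => [|[a d] [|[b d'] r]] //= st_eq [<-].
  have sp : size (take p st) = p.
    by rewrite size_takel //; apply: ltnW; rewrite -subn_gt0 -size_drop E.
  case: (eqVneq a b) => [ab|].
    have := @PureSlice c b (Cross s) (take p st) [:: (b, d); (b, d')] [:: (b, d'); (b, d)] r.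
    by rewrite ab in st_eq *; rewrite sp [_ ++ _ ++ _]st_eq; apply.
  move=> nab; have ba : b = ~~ a by move: nab; case: (a) (b) => -[].
  have := MixedSlice c a s (take p st) d d' r.
  by rewrite sp -ba [X in colored_slice _ _ X _]st_eq.
Qed.

Section ScolCat.
Variables (X : Type) (x0 : X).
Implicit Types s r : seq (X * bool).

Lemma scol_cat s u r : scol x0 (s ++ u :: r) (size s) = u.1.
Proof. by rewrite /scol nth_cat ltnn subnn. Qed.

Lemma scol_catS s u v r : scol x0 (s ++ [:: u, v & r]) (size s).+1 = v.1.
Proof. by rewrite -cat_rcons -(size_rcons s u) scol_cat. Qed.

Lemma map_scol_iota s r :
  [seq scol x0 (s ++ r) i | i <- iota 0 (size s)] = unzip1 s.
Proof.
rewrite (map_comp fst (nth (x0, true) (s ++ r))).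
by rewrite map_nth_iota0 ?size_cat ?leq_addr // take_size_cat.
Qed.
End ScolCat.

Lemma touched_pure x0 a c e (s1 mid s2 : seq (bool * bool)) :
  unzip1 mid = nseq (width_in e) a -> (if e is Cup _ then a = c else True) ->
  exists n, touched x0 c (size s1, e) (s1 ++ mid ++ s2) = nseq n.+1 a.
Proof.
have mid2 : unzip1 mid = nseq 2 a ->
    [:: scol x0 (s1 ++ mid ++ s2) (size s1); scol x0 (s1 ++ mid ++ s2) (size s1).+1]
    = nseq 2 a.
  by case: mid => [|u [|v []]] //= [<- va]; rewrite scol_cat scol_catS va.
by case: e => [o _ ->|/mid2 H _|s /mid2 H _]; [exists 0 | exists 1 | exists 1].
Qed.

Lemma sub_slice_pure P x0 a c e (s1 mid s2 : seq (bool * bool)) :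
  unzip1 mid = nseq (width_in e) a -> (if e is Cup _ then a = c else True) ->
  sub_slice P x0 c (size s1, e) (s1 ++ mid ++ s2)
  = if P a then [:: (count P (unzip1 s1), e)] else [::].
Proof.
move=> hm hc; rewrite /sub_slice; have [n ->] := touched_pure x0 s1 s2 hm hc.
by rewrite all_nseq /= map_scol_iota.
Qed.

Lemma sub_slice_mixed b x0 a c s s1 d d' s2 :
  sub_slice (pred1 b) x0 c (size s1, Cross s) (s1 ++ [:: (a, d), (~~ a, d') & s2])
  = [::].
Proof.
by rewrite /sub_slice /touched /= scol_cat scol_catS /=; case: a b => -[].
Qed.

Lemma sep_slice_pure a c e s1 mid s2 :
  unzip1 mid = nseq (width_in e) a -> (if e is Cup _ then a = c else True) ->
  sep_slice c (size s1, e) (s1 ++ mid ++ s2)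
  = [:: (sorted_pos a (unzip1 s1) (unzip1 s2), e)].
Proof.
move=> hm hc; rewrite /sep_slice; have [n ->] := touched_pure false s1 s2 hm hc.
rewrite [head _ _]/= all_pred1_nseq take_size_cat //= catA drop_size_cat //.
by rewrite size_cat -(size_map fst mid) [map _ _]hm size_nseq.
Qed.

Lemma sep_slice_mixed a c s s1 d d' s2 :
  sep_slice c (size s1, Cross s) (s1 ++ [:: (a, d), (~~ a, d') & s2]) = [::].
Proof.
by rewrite /sep_slice /touched /= scol_cat scol_catS /= eqxx; case: a.
Qed.

Lemma over_slice_pure a c e s1 mid s2 :
  unzip1 mid = nseq (width_in e) a ->
  over_slice c (size s1, e) (s1 ++ mid ++ s2) = [:: (size s1, e)].
Proof.
case: e => //= s; case: mid => [|u [|v []]] //= [ua va].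
by rewrite /over_slice /= scol_cat scol_catS ua va eqxx.
Qed.

Lemma over_slice_mixed a c s s1 d d' s2 :
  over_slice c (size s1, Cross s) (s1 ++ [:: (a, d), (~~ a, d') & s2])
  = [:: (size s1, Cross a)].
Proof. by rewrite /over_slice /= scol_cat scol_catS /=; case: a. Qed.

(** Isotopy moves only relate closed diagrams, so pieces of diagrams are compared inside every
    context that closes them into a link. *)
Definition tangle_isotopic (s t : seq (unit * bool)) (A B : diagram) :=
  [/\ urun A s = Some t, urun B s = Some t &
    forall low high, urun low [::] = Some s -> urun high t = Some [::] ->
      isotopic (low ++ A ++ high) (low ++ B ++ high)].

Lemma tangle_isotopic_trans s t A B C :
  tangle_isotopic s t A B -> tangle_isotopic s t B C -> tangle_isotopic s t A C.
Proof.
move=> [hA _ iAB] [_ hC iBC]; split=> // low high hl hh.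
exact: rst_trans (iAB _ _ hl hh) (iBC _ _ hl hh).
Qed.

Lemma tangle_isotopic_red b s t A B :
  redd b A B -> urun (if b then A else B) s = Some t -> tangle_isotopic s t A B.
Proof.
have main A' B' : red A' B' -> urun A' s = Some t -> tangle_isotopic s t A' B'.
  move=> r hA; split=> //; first exact: red_urun r hA.
  move=> low high hl hh; have [] // := @red_isotopic _ (low ++ B' ++ high) _ (red_ctx low high r).
  by apply/is_linkP; rewrite !urun_cat hl /= urun_cat hA.
case: b => r h; first exact: main.
have [hB hA i] := main _ _ r h; split=> // low high hl hh.
by apply: rst_sym; apply: i.
Qed.

Lemma tangle_isotopic_ctx s0 s t t1 L H A B :
  urun L s0 = Some s -> tangle_isotopic s t A B -> urun H t = Some t1 ->
  tangle_isotopic s0 t1 (L ++ A ++ H) (L ++ B ++ H).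
Proof.
move=> hL [hA hB i] hH; split; rewrite ?urun_cat ?hL /= ?urun_cat ?hA ?hB //.
move=> low high hl hh; rewrite -!catA (catA low) (catA low L); apply: i.
  by rewrite urun_cat hl.
by rewrite urun_cat hH.
Qed.

Lemma urun_local n e (m m' l r : seq (unit * bool)) :
  size l = n -> (forall r', urun [:: (0, e)] (m ++ r') = Some (m' ++ r')) ->
  urun [:: (n, e)] (l ++ m ++ r) = Some (l ++ m' ++ r).
Proof.
move=> <- H; elim: l => [|u l IH]; first exact: H.
by have := urun_shift1 [:: (size l, e)] u (l ++ m ++ r); rewrite IH.
Qed.

(** The sorting braid goes from above a slice to below it. Iterated over a link diagram, this
    removes all mixed crossings, since the braid is trivial at the top and at the bottom. *)
Lemma slice_separation c x st st1 :
  gstep eq_op c x st = Some st1 ->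
  tangle_isotopic (forget_color st) (forget_color (sort_strands id st1))
    (over_slice c x st ++ sortb (unzip1 st1))
    (sortb (unzip1 st) ++ sep_slice c x st).
Proof.
move=> /colored_sliceP[].
- move=> a e s1 mid mid' s2 hm hm' hc loc.
  rewrite (over_slice_pure c s1 s2 hm) (sep_slice_pure s1 s2 hm hc).
  apply: (@tangle_isotopic_red (dir e)).
    have:= sortb_event e a (unzip1 s1) (unzip1 s2).
    by rewrite -hm -hm' -!map_cat size_map.
  (* [dir e] decides which of the two sides the reduction starts from, so both of them are shown to
     run. *)
  have key1 : urun ((size s1, e) :: sortb (unzip1 (s1 ++ mid' ++ s2)))
      (forget_color (s1 ++ mid ++ s2))
      = Some (forget_color (sort_strands id (s1 ++ mid' ++ s2))).
    rewrite -cat1s urun_cat /forget_color /recolor !map_cat.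
    rewrite (urun_local (m' := forget_color mid')) ?size_map //=.
    by rewrite -!map_cat; apply: urun_sortb.
  have key2 : urun (sortb (unzip1 (s1 ++ mid ++ s2)) ++
        [:: (sorted_pos a (unzip1 s1) (unzip1 s2), e)])
      (forget_color (s1 ++ mid ++ s2))
      = Some (forget_color (sort_strands id (s1 ++ mid' ++ s2))).
    rewrite urun_cat urun_sortb /= /sort_strands !filter_cat.
    have filt (m : seq (bool * bool)) n : unzip1 m = nseq n a ->
        ([seq u <- m | u.1] = if a then m else [::]) *
        ([seq u <- m | ~~ u.1] = if a then [::] else m).
      elim: m n => [|[b d] m IH] [|n] //=; first by case: (a).
      by move=> [-> /IH[-> ->]]; case: (a).
    have [-> ->] := filt _ _ hm; have [-> ->] := filt _ _ hm'.
    rewrite /sorted_pos; case: (a); rewrite !cat0s /forget_color /recolor !map_cat.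
      rewrite -!catA (urun_local (m' := forget_color mid')) //.
      by rewrite size_map size_filter count_map.
    rewrite !catA -[in LHS]catA -[in RHS]catA (urun_local (m' := forget_color mid')) //.
    by rewrite !size_cat !size_map !size_filter !count_cat !count_map.
  by case: (dir e).
- move=> a s s1 d d' s2; rewrite over_slice_mixed sep_slice_mixed cats0.
  apply: (@tangle_isotopic_red true).
    have:= sortb_mixed a (unzip1 s1) (unzip1 s2).
    by rewrite /unzip1 !map_cat /= size_map.
  rewrite -cat1s urun_cat /forget_color /recolor map_cat.
  rewrite (urun_local (m := [:: _; _]) (m' := [:: (tt, d'); (tt, d)])) ?size_map //=.
  have := urun_sortb (s1 ++ [:: (~~ a, d'), (a, d) & s2]).
  by rewrite /forget_color /recolor map_cat.
Qed.

Lemma crun_cons phi x D (st st' : seq (bool * bool)) :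
  grun eq_op phi (x :: D) st = Some st' ->
  exists2 st1, gstep eq_op (phi 0) x st = Some st1 /\
    gstep (@anyrel bool) (phi 0) x st = Some st1
  & grun eq_op (phi \o S) D st1 = Some st'.
Proof.
rewrite /=; case E: (gstep _ _ _ _) => [st1|] //= H; exists st1 => //; split=> //.
have:= @grun_sub _ eq_op (@anyrel bool) phi [:: x] st st1 (fun _ _ _ => isT).
by rewrite /= E => /(_ erefl); case: (gstep _ _ _ _).
Qed.

Lemma separation phi D st st' :
  grun eq_op phi D st = Some st' ->
  tangle_isotopic (forget_color st) (forget_color (sort_strands id st'))
    (traverse over_slice phi D st ++ sortb (unzip1 st'))
    (sortb (unzip1 st) ++ traverse sep_slice phi D st).
Proof.
elim: D phi st => [|x D IH] phi st.
  by move=> [<-] /=; rewrite cats0; apply: (@tangle_isotopic_red true);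
    [apply: red_refl | apply: urun_sortb].
move=> /crun_cons[st1 [hx hx'] hD] /=; rewrite hx' /=.
have {IH} iD := IH _ _ hD; have ix := slice_separation hx.
have hover : urun (over_slice (phi 0) x st) (forget_color st) = Some (forget_color st1).
  have: urun [:: x] (forget_color st) = Some (forget_color st1).
    by apply: (@grun_urun _ eq_op phi); rewrite /= hx.
  by case: (x) => p [].
have [_ hs _] := iD; have [hs1 _ _] := ix.
apply: (tangle_isotopic_trans (B := over_slice (phi 0) x st ++
    sortb (unzip1 st1) ++ traverse sep_slice (phi \o S) D st1)).
  have:= tangle_isotopic_ctx hover iD (H := [::]) erefl.
  by rewrite !cats0 -?catA.
have hsep : urun (traverse sep_slice (phi \o S) D st1)
    (forget_color (sort_strands id st1)) = Some (forget_color (sort_strands id st')).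
  by move: hs; rewrite urun_cat urun_sortb.
have:= tangle_isotopic_ctx (L := [::]) erefl ix hsep.
by rewrite /= -?catA.
Qed.

Lemma traverse_cons Z (F : bool -> slice -> seq (bool * bool) -> seq Z) phi x D st st' :
  grun eq_op phi (x :: D) st = Some st' ->
  exists st1, [/\ gstep eq_op (phi 0) x st = Some st1,
    grun eq_op (phi \o S) D st1 = Some st'
  & traverse F phi (x :: D) st = F (phi 0) x st ++ traverse F (phi \o S) D st1].
Proof.
by move=> /crun_cons[st1 [h1 h2] h3]; exists st1; split=> //=; rewrite h2.
Qed.

(** The offset [j] is counted from the last strand of colour [true], so the position of the event
    follows the varying number of these strands while it moves up past the events of that colour. *)
Lemma exchange_true j e phi D st st' :
  grun eq_op phi D st = Some st' ->
  let T := traverse (sub_slice (pred1 true) false) phi D st in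
  red ((count id (unzip1 st) + j, e) :: T)
      (T ++ [:: (count id (unzip1 st') + j, e)]).
Proof.
elim: D phi st => [|x D IH] phi st; first by move=> [<-]; apply: red_refl.
move=> /(traverse_cons (sub_slice (pred1 true) false))[st1 [hx /IH{}IH ->]] /=.
case/colored_sliceP: hx IH => [a e' s1 mid mid' s2 hm hm' hc _|a s s1 d d' s2] IH.
- rewrite (sub_slice_pure _ _ _ _ hm hc) /= -catA.
  move: IH; rewrite /unzip1 !map_cat [map _ mid]hm [map _ mid']hm' !count_cat !count_nseq_out.
  case: a {hm hm' hc} => /=; rewrite ?muln1 ?muln0 // => IH.
  have -> : count (pred1 true) (map fst s1) = count id (map fst s1).
    by apply: eq_count => -[].
  apply: (red_trans (B := (count id (map fst s1), e') ::
      (count id (map fst s1) + (width_out e' + count id (map fst s2)) + j, e) ::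
      traverse (sub_slice (pred1 true) false) (phi \o S) D (s1 ++ mid' ++ s2))).
    apply: (redd_catr (b := true) _ (A := [:: _; _]) (B := [:: _; _])).
    have [] // := redd_local true (Exchange (count id (map fst s1)) (count id (map fst s2) + j) e' e) => _.
    by rewrite !addnA.
  exact: (redd_catl (b := true) [:: _] IH).
- rewrite sub_slice_mixed /=; move: IH; rewrite /unzip1 !map_cat !count_cat /=.
  by case: a.
Qed.

(** In the separated diagram an event of colour [false] lies to the right of all strands of colour
    [true]. It is thus far from every event of that colour and can be raised above all of them. *)
Lemma sep_split phi D st st' :
  grun eq_op phi D st = Some st' ->
  red (traverse sep_slice phi D st)
      (traverse (sub_slice (pred1 true) false) phi D st
       ++ shift (count id (unzip1 st'))
            (traverse (sub_slice (pred1 false) false) phi D st)).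
Proof.
elim: D phi st => [|x D IH] phi st; first by move=> _; apply: red_refl.
move=> h; have [st1 [hx hD ->]] := traverse_cons sep_slice h.
have [st2 [hx2 _ ->]] := traverse_cons (sub_slice (pred1 true) false) h.
have [st3 [hx3 _ ->]] := traverse_cons (sub_slice (pred1 false) false) h.
move: hx2 hx3; rewrite hx => -[<-] [<-] {st2 st3 h}.
have {IH} := IH _ _ hD; have push j e := exchange_true j e hD; move: push.
case/colored_sliceP: hx {hD} => [a e' s1 mid mid' s2 hm hm' hc _|a s s1 d d' s2] push IH.
- rewrite (sep_slice_pure _ _ hm hc) !(sub_slice_pure _ _ _ _ hm hc) /=.
  case: a hm hm' hc => /= hm hm' hc.
    rewrite /sorted_pos -/(unzip1 _) (eq_count (a2 := id)) => [|[]] //.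
    exact: (redd_catl (b := true) [:: _] IH).
  apply: red_trans (redd_catl (b := true) [:: _] IH) _.
  rewrite /= -cat_cons -cat_rcons -cats1.
  apply: (redd_catr (b := true)).
  have := push (count negb (unzip1 s1)) e'.
  rewrite /sorted_pos {1}/unzip1 !map_cat [map _ mid']hm' !count_cat !count_nseq_out muln0.
  by rewrite (eq_count (a1 := pred1 false) (a2 := negb)) => [|[]].
- by rewrite sep_slice_mixed !sub_slice_mixed.
Qed.

Lemma two_coloring_split phi D :
  grun eq_op phi D [::] = Some [::] ->
  is_link (traverse over_slice phi D [::]) /\
  isotopic (traverse over_slice phi D [::])
     (traverse (sub_slice (pred1 true) false) phi D [::]
      ++ traverse (sub_slice (pred1 false) false) phi D [::]).
Proof.
move=> h; have [h1 h2 i] := separation h.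
have := i [::] [::] erefl erefl; rewrite /= !cats0 in h1 * => {}i.
split; first exact/is_linkP.
have [|j _] := @red_isotopic _ _ _ (sep_split h); first exact/is_linkP.
by apply: rst_trans i _; rewrite shift0 in j.
Qed.

Lemma eq_traverse (X Z : Type) (F : X -> slice -> seq (X * bool) -> seq Z) phi psi D st :
  phi =1 psi -> traverse F phi D st = traverse F psi D st.
Proof.
elim: D phi psi st => [|x D IH] phi psi st e //=.
by rewrite e (IH _ (psi \o S)) // => k; apply: e.
Qed.

Lemma traverse_recolor (X Y Z : Type) (f : X -> Y)
    (F : X -> slice -> seq (X * bool) -> seq Z) G phi D st :
  (forall c x s, G (f c) x (recolor f s) = F c x s) ->
  traverse G (f \o phi) D (recolor f st) = traverse F phi D st.
Proof.
move=> FG; elim: D phi st => [|x D IH] phi st //=.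
rewrite FG gstep_recolor -IH; congr (_ ++ traverse _ _ _ _).
by rewrite -/(anyrel _); case: (gstep _ _ _ _).
Qed.

(** Bridge between the definitions by index, which recompute the strands below each slice, and the
    recursive sweep. *)
Lemma traverse_flatten Z (F : nat -> slice -> seq strand -> seq Z) D :
  is_link D ->
  flatten [seq F k (slice_at D k) (odflt [::] (strands (take k D)))
          | k <- iota 0 (size D)]
  = traverse F id D [::].
Proof.
suff main low high st st' : grun (@anyrel nat) id low [::] = Some st ->
    grun (@anyrel nat) (addn (size low)) high st = Some st' ->
    flatten [seq F k (slice_at (low ++ high) k)
                   (odflt [::] (strands (take k (low ++ high))))
            | k <- iota (size low) (size high)]
    = traverse F (addn (size low)) high st.
  rewrite is_linkE (urun_grun id D [::]); case E: (grun _ _ _ _) => [st|] // _.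
  by rewrite (@main [::] D [::] st).
elim: high low st => [|x high IH] low st //= hlow.
case E: (gstep _ _ _ _) => [st1|] //= hhigh.
have -> : slice_at (low ++ x :: high) (size low) = x.
  by rewrite /slice_at nth_cat ltnn subnn.
rewrite take_size_cat // strands_grun hlow addn0 in E *.
rewrite -cat_rcons; congr (_ ++ _).
rewrite -(size_rcons low x) (IH (rcons low x) st1).
- by apply: eq_traverse => k /=; rewrite size_rcons addSnnS.
- by rewrite -cats1 grun_cat hlow /= addn0 E.
- by rewrite -hhigh; apply: eq_grun => k _ /=; rewrite size_rcons addSnnS.
Qed.

(** * Colourings and components *)

(** A colouring of the local minima that is constant along each component. It refers to no computed
    representatives, and since a crossing change keeps the indices of the slices, it survives one as
    it is. *)
Definition coloring (X : eqType) (phi : nat -> X) (D : diagram) : Prop :=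
  grun eq_op phi D [::] = Some [::].

Definition cup_at (D : diagram) (k : nat) : bool :=
  if (slice_at D k).2 is Cup _ then true else false.

Lemma mem_cups D k : (k \in cups D) = cup_at D k.
Proof.
rewrite mem_filter mem_iota /= /cup_at add0n.
by case: ltnP; rewrite ?andbT // => h; rewrite /slice_at nth_default.
Qed.

Lemma coloring_is_link (X : eqType) (phi : nat -> X) D : coloring phi D -> is_link D.
Proof. by move=> /(@grun_urun _ _ _ _ [::])/is_linkP. Qed.

Definition join_slice (X : Type) (x0 c : X) (x : slice) st : seq (X * X) :=
  if x.2 is Cap then [:: (scol x0 st x.1, scol x0 st x.1.+1)] else [::].

(** The test occurs only at local maxima and does not affect the resulting strands, so all the tests
    can be postponed to the list of joined colours. *)
Lemma grun_joins (X : Type) (x0 : X) ok phi D st st' :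
  grun (@anyrel X) phi D st = Some st' ->
  grun ok phi D st =
  if all (fun ab => ok ab.1 ab.2) (traverse (join_slice x0) phi D st)
  then Some st' else None.
Proof.
elim: D phi st => [|[p e] D IH] phi st; first by move=> [<-].
rewrite /=; case E: (gstep _ _ _ _) => [st1|] //= /IH{}IH; rewrite all_cat.
case: e E => [o||s] E; rewrite /join_slice /=; first by rewrite [gstep ok _ _ _]E; apply: IH.
- rewrite andbT; move: E; rewrite /gstep /scol.
  have := cat_take_drop p st; case E: (drop p st) => [|u [|v r]] //= st_eq.
  have sp : size (take p st) = p.
    by rewrite size_takel //; apply: ltnW; rewrite -subn_gt0 -size_drop E.
  have [-> ->] : nth (x0, true) st p = u /\ nth (x0, true) st p.+1 = v.
    rewrite -st_eq !nth_cat sp ltnn subnn ltnNge leqnSn subSnn; split=> //.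
  case: ifP => // ne [E1]; rewrite andbT E1.
  by case: (ok _ _) => //; apply: IH.
- by rewrite [gstep ok _ _ _]E; apply: IH.
Qed.

Lemma joins_traverse D : is_link D -> joins D = traverse (join_slice 0) id D [::].
Proof.
move=> lD; rewrite -traverse_flatten //; congr flatten; apply: eq_map => k.
by case: (slice_at D k) => p e.
Qed.

Lemma coloringE (X : eqType) (phi : nat -> X) D : is_link D ->
  coloring phi D <-> all (fun ab => phi ab.1 == phi ab.2) (joins D).
Proof.
move=> lD; have := lD; rewrite is_linkE (urun_grun id D [::]).
case E: (grun _ _ _ _) => [[|//]|] // _.
rewrite /coloring (grun_recolor phi eq_op id D [::]) (grun_joins 0 _ E).
by rewrite -joins_traverse //; case: all.
Qed.

Definition merge (f : nat -> nat) (ab : nat * nat) (c : nat) : nat :=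
  if f c == f ab.1 then f ab.2 else f c.

Lemma repE D : rep D = foldl merge id (joins D).
Proof. by []. Qed.

(** Each merger only identifies labels to which [phi] already gives the same colour. *)
Lemma coloring_rep (X : eqType) (phi : nat -> X) D a :
  coloring phi D -> phi (rep D a) = phi a.
Proof.
move=> h; have /(coloringE _ (coloring_is_link h)) := h; rewrite repE.
suff main js f : (forall c, phi (f c) = phi c) ->
    all (fun ab => phi ab.1 == phi ab.2) js -> phi (foldl merge f js a) = phi a.
  exact: main.
elim: js f => [|ab js IH] f hf; first by move=> _; apply: hf.
move=> /= /andP[/eqP hab]; apply: IH => c; rewrite /merge; case: eqP => // e.
by rewrite hf -hab -(hf ab.1) -e hf.
Qed.

Lemma rep_coloring D : is_link D -> coloring (rep D) D.
Proof.
move=> /coloringE ->; rewrite repE.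
suff main js f : (forall x y, f x = f y -> foldl merge f js x = foldl merge f js y) /\
    all (fun ab => foldl merge f js ab.1 == foldl merge f js ab.2) js.
  by have [] := main (joins D) id.
elim: js f => [|[a b] js IH] f //=.
have [IH1 IH2] := IH (merge f (a, b)).
split=> [x y e|]; first by apply: IH1; rewrite /merge e.
by rewrite IH2 andbT; apply/eqP/IH1; rewrite /merge eqxx; case: ifP.
Qed.

Lemma knot_of_coloring D :
  is_link D -> (exists k, cup_at D k) ->
  (forall psi : nat -> bool, coloring psi D ->
     exists b, forall k, cup_at D k -> psi k = b) ->
  is_knot D.
Proof.
move=> lD [k0 hk0] const; rewrite /is_knot lD /=.
have [|b hb] := const (fun a => rep D a == rep D k0).
  have /(coloringE _ lD) := rep_coloring lD => h; apply/coloringE => //.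
  by apply: sub_all h => ab /= /eqP ->.
have b1 := hb _ hk0; rewrite eqxx in b1.
have : all (pred1 (rep D k0)) [seq rep D a | a <- cups D].
  apply/allP => _ /mapP[a ha ->] /=.
  by rewrite mem_cups in ha; have := hb _ ha; rewrite -b1 => ->.
rewrite /components => /all_pred1P ->; rewrite size_map.
have: 0 < size (cups D) by case: (cups D) (mem_cups D k0) => //; rewrite hk0.
case: (size _) => // n _; elim: n => // n.
by rewrite /= inE eqxx.
Qed.

(** There are at most two components and [phi] tells them apart: every colouring by booleans factors
    through it. In this form the property passes directly through a crossing change. *)
Definition bicoloring (phi : nat -> bool) (D : diagram) : Prop :=
  coloring phi D /\
  forall psi : nat -> bool, coloring psi D ->
    exists f : bool -> bool, forall k, cup_at D k -> psi k = f (phi k).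

Lemma two_components_bicoloring D c1 c2 : is_link D ->
  perm_eq (components D) [:: c1; c2] ->
  bicoloring (fun a => rep D a == c1) D /\
  forall k, cup_at D k -> (rep D k == c2) = ~~ (rep D k == c1).
Proof.
move=> lD comps; have c12 : c1 != c2.
  by move: (perm_uniq comps); rewrite undup_uniq /= inE andbT => /esym.
have rep12 k : cup_at D k -> (rep D k == c1) || (rep D k == c2).
  rewrite -mem_cups => hk; have: rep D k \in [:: c1; c2].
    by rewrite -(perm_mem comps) mem_undup; apply: map_f.
  by rewrite !inE.
split; last first.
  move=> k /rep12; case: (eqVneq (rep D k) c1) => [-> _|_ /= ->] //.
  exact: negbTE.
have hr := rep_coloring lD; split.
  move/(coloringE _ lD): hr => hr; apply/coloringE => //.
  by apply: sub_all hr => ab /= /eqP ->.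
move=> psi hpsi; exists (fun b => if b then psi c1 else psi c2) => k hk.
rewrite -(coloring_rep k hpsi); case: eqP => [->//|/eqP/negbTE n1].
by have := rep12 _ hk; rewrite n1 /= => /eqP ->.
Qed.

Lemma sublink_traverse P D :
  is_link D -> sublink P D = traverse (sub_slice P 0) id D [::].
Proof.
move=> lD; rewrite -traverse_flatten //; congr flatten; apply: eq_map => k.
case: (slice_at D k) => p e; rewrite /sub_slice /touched /=.
by case: e.
Qed.

Lemma eq_traverse_cups (X : Type) (P : pred X) x0 phi psi D st :
  (forall k, cup_at D k -> phi k = psi k) ->
  traverse (sub_slice P x0) phi D st = traverse (sub_slice P x0) psi D st.
Proof.
elim: D phi psi st => [|[p e] D IH] phi psi st eqf //=.
have -> : gstep (@anyrel X) (phi 0) (p, e) st = gstep (@anyrel X) (psi 0) (p, e) st.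
  by case: e eqf => //= o eqf; rewrite (eqf 0).
rewrite (IH (phi \o S) (psi \o S)) => [|k]; last exact: (eqf k.+1).
congr (_ ++ _); case: e eqf => //= o eqf.
by rewrite /sub_slice /touched /= (eqf 0).
Qed.

Lemma sub_slice_default b x0 y0 (phi : nat -> bool) D st st' :
  grun eq_op phi D st = Some st' ->
  traverse (sub_slice (pred1 b) x0) phi D st
  = traverse (sub_slice (pred1 b) y0) phi D st.
Proof.
elim: D phi st => [|x D IH] phi st // h.
have [st1 [hx hD ->]] := traverse_cons (sub_slice (pred1 b) x0) h.
have [st2 [hx2 _ ->]] := traverse_cons (sub_slice (pred1 b) y0) h.
move: hx2; rewrite hx => -[<-] {st2 h}; rewrite (IH _ _ hD); congr (_ ++ _).
case/colored_sliceP: hx => [a e s1 mid mid' s2 hm hm' hc _|a s s1 d d' s2].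
- by rewrite !(sub_slice_pure _ _ _ _ hm hc).
- by rewrite !sub_slice_mixed.
Qed.

Lemma sublink_coloring b (P : pred nat) (phi : nat -> bool) D :
  coloring phi D -> (forall k, cup_at D k -> P k = (phi k == b)) ->
  sublink P D = traverse (sub_slice (pred1 b) false) phi D [::].
Proof.
move=> hphi hP; rewrite (sublink_traverse _ (coloring_is_link hphi)).
(* Strands out of range have label 0 by default, so the default colour is chosen to equal [b]
   exactly when [P 0] holds. Both sweeps then have the same image on truth values. *)
pose x0 := if P 0 then b else ~~ b.
rewrite (sub_slice_default b false x0 hphi).
have eqPx0 : (x0 == b) = P 0 by rewrite /x0; case: (P 0); rewrite ?eqxx //; case: (b).
rewrite -(@traverse_recolor _ _ _ P (sub_slice P 0) (sub_slice id (P 0))); last first.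
  move=> c x s; rewrite /sub_slice /touched.
  have sc i : scol (P 0) (recolor P s) i = P (scol 0 s i).
    rewrite /scol /recolor -[(P 0, true)]/((fun u : nat * bool => (P u.1, u.2)) (0, true)).
    case: (ltnP i (size s)) => h; first by rewrite (nth_map (0, true)).
    by rewrite !nth_default ?size_map.
  rewrite !sc; rewrite (eq_map (fun i => sc i)) (map_comp P) count_map.
  by case: (x.2).
rewrite [recolor _ _]/= -(@traverse_recolor _ _ _ (pred1 b)
  (sub_slice (pred1 b) x0) (sub_slice id (P 0)) phi); last first.
  move=> c x s; rewrite /sub_slice /touched.
  have sc i : scol (P 0) (recolor (pred1 b) s) i = pred1 b (scol x0 s i).
    rewrite /scol /recolor; case: (ltnP i (size s)) => h.
      by rewrite (nth_map (x0, true)).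
    by rewrite !nth_default ?size_map //= eqPx0.
  rewrite !sc; rewrite (eq_map (fun i => sc i)) (map_comp (pred1 b)) count_map.
  by case: (x.2).
exact: eq_traverse_cups.
Qed.

(** * Smoothing a mixed crossing gives a knot *)

Section Flux.
Local Open Scope ring_scope.
Variable X : eqType.
Implicit Types (x : X) (st : seq (X * bool)).

(* The strands of a given colour are oriented consistently, so as many of them
   are directed upwards as downwards. *)
Definition flux x st : int :=
  \sum_(u <- st | u.1 == x) (if u.2 then 1 else -1).

Lemma flux_cat x s t : flux x (s ++ t) = flux x s + flux x t.
Proof. exact: big_cat. Qed.

Lemma flux_cons x u s :
  flux x (u :: s) = (if u.1 == x then if u.2 then 1 else -1 else 0) + flux x s.
Proof. by rewrite /flux big_cons; case: ifP; rewrite ?add0r. Qed.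

Lemma flux_nil x : flux x [::] = 0.
Proof. exact: big_nil. Qed.

Lemma flux_grun x phi D st st' :
  grun eq_op phi D st = Some st' -> flux x st' = flux x st.
Proof.
elim: D phi st => [|[p e] D IH] phi st; first by move=> [<-].
rewrite /=; case E: (gstep _ _ _ _) => [st1|] //= /IH ->.
rewrite -[X in _ = flux x X](cat_take_drop p st).
move: E; rewrite /gstep; case: e => [o||s].
- case: ifP => // _ [<-]; rewrite !flux_cat !flux_cons /=.
  by congr (_ + _); case: ifP; case: o => _; rewrite addrA ?addrN ?addNr ?add0r.
- case: (drop p st) => [|u [|v r]] //=; case: ifP => // /andP[/eqP uv duv] [<-].
  rewrite !flux_cat !flux_cons uv; congr (_ + _).
  by case: (u.2) (v.2) duv => -[] //; case: ifP => _ _; rewrite addrA ?addrN ?addNr ?add0r.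
- case: (drop p st) => [|u [|v r]] //= [<-].
  by rewrite !flux_cat !flux_cons (addrCA _ _ (flux x r)).
Qed.
End Flux.

(** Two colourings of one diagram run on the same strands and so combine into pairs of colours,
    whose fluxes can then be counted. *)
Lemma grun_pair (phi psi : nat -> bool) D (st : seq ((bool * bool) * bool)) s t :
  grun eq_op phi D (recolor fst st) = Some s ->
  grun eq_op psi D (recolor snd st) = Some t ->
  exists2 r, grun eq_op (fun k => (phi k, psi k)) D st = Some r &
    recolor fst r = s /\ recolor snd r = t.
Proof.
rewrite -[phi]/(fst \o (fun k => (phi k, psi k))) grun_recolor.
rewrite -[X in grun _ X _ (recolor snd _)]/(snd \o (fun k => (phi k, psi k))).
rewrite grun_recolor.
case E1: (grun _ _ _ _) => [r|] // [<-]; case E2: (grun _ _ _ _) => [r'|] // [<-].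
have rr' : r' = r.
  have := grun_sub (ok' := @anyrel _) (fun _ _ _ => isT) E2.
  by rewrite (grun_sub (ok' := @anyrel _) (fun _ _ _ => isT) E1) => -[].
exists r; last by rewrite rr'.
apply: grun_sub (grun_and E1 E2) => -[a b] [c d] /=.
by rewrite xpair_eqE.
Qed.

Lemma coloring_cat (X : eqType) (phi : nat -> X) low high :
  coloring phi (low ++ high) ->
  exists st, [/\ strands low = Some st, grun eq_op phi low [::] = Some (recolor phi st)
    & grun eq_op (fun j => phi (size low + j)) high (recolor phi st) = Some [::]].
Proof.
rewrite /coloring grun_cat; case E: (grun _ _ low _) => [t|] //= hhigh.
have := grun_sub (ok' := @anyrel X) (fun _ _ _ => isT) E.
rewrite (grun_recolor phi (@anyrel X) id low [::]) -/(anyrel _) strands_grun.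
by case: (grun _ _ _ _) => [st|] //= [tE]; exists st; rewrite tE.
Qed.

Lemma slice_at_cat A B k :
  slice_at (A ++ B) k = if k < size A then slice_at A k else slice_at B (k - size A).
Proof. exact: nth_cat. Qed.

(* The strands at a mixed crossing have different colours [a] and [a']. The
   fluxes of the pairs of colours below and above the crossing then show that a
   colouring of the smoothed diagram also extends through the crossing. *)
Lemma flux_crossing (a a' x y x' y' d d' : bool) (A B : seq ((bool * bool) * bool)) :
  a != a' ->
  (forall c, flux c (A ++ [:: ((a, x), d), ((a', y), d') & B]) = 0%R) ->
  (forall c, flux c (A ++ [:: ((a', x'), d'), ((a, y'), d) & B]) = 0%R) ->
  x' = y /\ y' = x.
Proof.
move=> na h1 h2; split; apply/eqP; rewrite eq_sym.
- have := etrans (h1 (a', y)) (esym (h2 (a', y))).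
  rewrite !flux_cat !flux_cons /= !xpair_eqE (negbTE na) !eqxx /= ?add0r.
  move=> /addrI; rewrite (eq_sym x'); case: (y == x') => //.
  by move=> /addIr; case: (d').
- have := etrans (h1 (a, x)) (esym (h2 (a, x))).
  rewrite !flux_cat !flux_cons /= !xpair_eqE (eq_sym a') (negbTE na) !eqxx /= ?add0r.
  move=> /addrI; rewrite (eq_sym y'); case: (x == y') => //.
  by move=> /addIr; case: (d).
Qed.

Lemma strands_crossing (phi : nat -> bool) low p s high st :
  coloring phi (low ++ (p, Cross s) :: high) -> strands low = Some st ->
  exists A u v B, [/\ st = A ++ [:: u, v & B], p = size A
   & grun eq_op (fun j => phi ((size low + j).+1)) high
      (recolor phi (A ++ [:: v, u & B])) = Some [::] ].
Proof.
move=> /coloring_cat[st' [-> _ h]] [<-]; move: h => /=.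
rewrite gstep_recolor /gstep.
have := cat_take_drop p st'; case E: (drop p st') => [|u [|v B]] //= st_eq h.
exists (take p st'), u, v, B; split=> //.
  by rewrite size_takel //; apply: ltnW; rewrite -subn_gt0 -size_drop E.
by rewrite -h; apply: eq_grun => k _ /=; rewrite addnS.
Qed.

Definition resolution (p : nat) (u v : strand) : diagram :=
  if u.2 == v.2 then [::] else [:: (p, Cap); (p, Cup v.2)].

(** Parallel strands keep their colours, while antiparallel ones are cut and replaced by an arc of a
    single new colour. The disjunction lets both kinds of smoothing be treated at once. *)
Lemma grun_resolution (X : Type) (ok : rel X) (phi : nat -> X) (x y : X)
    (u v : strand) (A B : seq (X * bool)) t :
  grun ok phi (resolution (size A) u v) (A ++ [:: (x, u.2), (y, v.2) & B]) = Some t ->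
  exists x' y', [/\ t = A ++ [:: (x', v.2), (y', u.2) & B],
     (x' = x /\ y' = y) \/ x' = y'
   & forall k, cup_at (resolution (size A) u v) k -> phi k = x'].
Proof.
rewrite /resolution; case: eqP => [uv [<-]|/eqP uv] /=.
  exists x, y; split; [by rewrite uv|by left|].
  by move=> k; rewrite /cup_at /slice_at nth_nil.
rewrite gstep_size_cat gstep_cap0 /= uv andbT; case: (ok x y) => //=.
rewrite gstep_size_cat gstep_cup0 /= => -[<-].
exists (phi 1), (phi 1); split; [|by right|by case=> [|[|k]]; rewrite // /cup_at /slice_at nth_default].
by congr (_ ++ [:: _, (_, _) & _]); case: (u.2) (v.2) uv => -[].
Qed.

Lemma urun_resolution (u v : strand) (A B : seq strand) :
  urun (resolution (size A) u v) (forget_color (A ++ [:: u, v & B]))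
  = Some (forget_color (A ++ [:: v, u & B])).
Proof.
rewrite /forget_color /recolor !map_cat /= /urun /resolution.
case: eqP => [-> //|/eqP uv] /=.
rewrite -(size_map (fun u : strand => (tt, u.2))) gstep_size_cat gstep_cap0 /= uv /=.
rewrite gstep_size_cat gstep_cup0 /=.
by congr (Some (_ ++ [:: _, (_, _) & _])); case: (u.2) (v.2) uv => -[].
Qed.

(** Let [psi] colour the smoothed diagram. The fluxes of the pairs ([phi], [psi]) force the colours
    above the smoothing to be those that a crossing would carry up, so [psi] agrees on the two
    strands and extends to the crossed diagram. There it factors through [phi]; as [phi] differs on
    the two strands, [psi] is constant. *)
Lemma smoothing_knot (phi : nat -> bool) low p s high :
  bicoloring phi (low ++ (p, Cross s) :: high) ->
  phi (label low p) != phi (label low p.+1) ->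
  is_knot (smoothed low p high).
Proof.
move=> [hphi maxphi]; have [st [hst hlow _]] := coloring_cat hphi.
have [A [u [v [B [stE pE hhigh]]]]] := strands_crossing hphi hst.
have [topu topv] : top_strand low p = u /\ top_strand low p.+1 = v.
  by rewrite /top_strand hst stE pE /= !nth_cat ltnn subnn ltnNge leqnSn subSnn.
rewrite /label /smoothed /upward topu topv => nuv.
rewrite -/(resolution p u v); set mid := resolution p u v; set n := size low.
have lD0 : is_link (low ++ mid ++ high).
  apply/is_linkP; rewrite urun_cat.
  rewrite [urun low _](grun_urun hlow) /= urun_cat.
  rewrite -[forget_color _]/(recolor (fun _ => tt) (recolor phi st)) recolor_comp.
  rewrite stE [urun mid _](_ : _ = Some (forget_color (A ++ [:: v, u & B]))) /=; last first.
    by rewrite /mid pE; apply: urun_resolution.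
  have := grun_urun hhigh; rewrite /forget_color recolor_comp; exact.
have D0_cup : exists k, cup_at (low ++ mid ++ high) k.
  exists 0; move: lD0 hst; rewrite is_linkE stE.
  case: (low) => [|[[|q] [o||b]] low'] //=.
    by case: (A) => [|? ?] [].
apply: knot_of_coloring => // psi hpsi.
have [st' [hst' hlow' hrest]] := coloring_cat hpsi.
move: hst'; rewrite hst => -[st'E]; rewrite -{st'}st'E in hlow' hrest.
move: hrest; rewrite grun_cat; case hmid: (grun _ _ mid _) => [t|] //= hhigh'.
have pE' : p = size (recolor psi A) by rewrite size_map.
have sE : recolor psi st
    = recolor psi A ++ [:: (psi u.1, u.2), (psi v.1, v.2) & recolor psi B].
  by rewrite stE /recolor map_cat.
rewrite sE /mid pE' in hmid.
have [x' [y' [tE xy hcup]]] := grun_resolution hmid; rewrite -pE' -/mid in hcup.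
have [r1 hr1 [_ _]] := @grun_pair phi psi low [::] _ _ hlow hlow'.
have := grun_sub (ok' := @anyrel _) (fun _ _ _ => isT) hr1.
rewrite (grun_recolor (fun k => (phi k, psi k)) (@anyrel _) id low [::]).
rewrite -/(anyrel _) -strands_grun hst /= => -[r1E].
pose P : seq strand -> seq ((bool * bool) * bool) := recolor (fun k => (phi k, psi k)).
(* [S] joins the colours of [phi] above the crossing with those of [psi] above the smoothing. Both
   start a run of [high] that closes up, so its fluxes vanish like those below. *)
pose S := P A ++ [:: ((phi v.1, x'), v.2), ((phi u.1, y'), u.2) & P B].
have hS1 : recolor fst S = recolor phi (A ++ [:: v, u & B]).
  by rewrite /S /P /recolor !map_cat /= -!map_comp.
have hS2 : recolor snd S = t.
  by rewrite tE /S /P /recolor !map_cat /= -!map_comp.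
rewrite -hS1 in hhigh; rewrite -hS2 in hhigh'.
have [r2 hr2 [r2a _]] := grun_pair hhigh hhigh'.
have [xv yu] : x' = psi v.1 /\ y' = psi u.1.
  apply: (@flux_crossing (phi u.1) (phi v.1) _ _ _ _ u.2 v.2 (P A) (P B)) => // c.
    have := flux_grun c hr1; rewrite flux_nil -r1E stE /P /recolor map_cat /=.
    by [].
  by have := flux_grun c hr2; case: (r2) r2a => // _; rewrite flux_nil.
have psiuv : psi u.1 = psi v.1.
  by case: xy => [[<- _]|]; rewrite -?yu // xv => ->; rewrite yu.
have t_eq : t = recolor psi (A ++ [:: v, u & B]).
  by rewrite tE xv yu /recolor map_cat.
rewrite hS2 t_eq in hhigh'.
have lt_cup D k : cup_at D k -> k < size D.
  by rewrite /cup_at /slice_at; case: ltnP => // h; rewrite nth_default.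
(* Reindexing: the single slice of the crossing replaces the [size mid] slices of the resolution.
   The value at [n] is never read, because that slice is not a local minimum. *)
pose psi' k := if k <= n then psi k else psi (n + (size mid + (k - n.+1))).
have hpsi' : coloring psi' (low ++ (p, Cross s) :: high).
  rewrite /coloring grun_cat (@eq_grun _ _ _ psi) => [|k /lt_cup hk]; last first.
    by rewrite /psi' ltnW.
  rewrite hlow' /= sE pE' gstep_size_cat /= -[RHS]hhigh' /recolor map_cat.
  apply: eq_grun => k _.
  by rewrite /= /psi' addnS ltnNge leq_addr /= subSS addKn.
have [f hf] := maxphi _ hpsi'.
have cat_cup D D' k : cup_at D k -> cup_at (D ++ D') k.
  by move=> hk; rewrite /cup_at slice_at_cat lt_cup.
have : recolor psi st = recolor (f \o phi) st.
  have hrun X (chi : nat -> X) : grun (@anyrel X) chi low [::] = Some (recolor chi st).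
    rewrite (grun_recolor chi (@anyrel X) id low [::]).
    by rewrite -/(anyrel _) -strands_grun hst.
  apply: Some_inj; rewrite -!hrun; apply: eq_grun => k hk.
  by rewrite /= -hf /psi' ?(ltnW (lt_cup _ _ hk)) //; apply: cat_cup.
rewrite sE stE /recolor map_cat => /eqP; rewrite eqseq_cat ?size_map //.
move=> /andP[_ /eqP[fu fv _]].
have fconst c : f c = psi u.1.
  by have [->|->] : c = phi u.1 \/ c = phi v.1; rewrite -?fu -?fv ?psiuv //;
    case: c (phi u.1) (phi v.1) nuv => [] [] [] //; auto.
exists (psi u.1) => k; rewrite /cup_at slice_at_cat; case: ltnP => [hk hc|hk].
  by rewrite -(fconst (phi k)) -hf /psi' ?(ltnW hk) // /cup_at slice_at_cat hk.
rewrite slice_at_cat; case: ltnP => [_ /hcup|hk' hc].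
  by rewrite subnKC // psiuv xv.
rewrite -(fconst (phi (n.+1 + (k - n - size mid)))) -hf.
  by rewrite /psi' leqNgt leq_addr /= addKn !subnKC // leq_subRL.
rewrite /cup_at slice_at_cat ltnNge ltnW ?leq_addr //=.
by rewrite addSn -addnS addKn.
Qed.

(** * Changing the mixed crossings *)

Lemma coloring_crossing (X : eqType) (phi : nat -> X) low p s s' high :
  coloring phi (low ++ (p, Cross s) :: high) ->
  coloring phi (low ++ (p, Cross s') :: high).
Proof. by rewrite /coloring !grun_cat. Qed.

Lemma cup_at_crossing low p s s' high k :
  cup_at (low ++ (p, Cross s) :: high) k = cup_at (low ++ (p, Cross s') :: high) k.
Proof. by rewrite /cup_at !slice_at_cat; case: ifP => // _; case: (k - _). Qed.

Lemma bicoloring_crossing phi low p s s' high :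
  bicoloring phi (low ++ (p, Cross s) :: high) ->
  bicoloring phi (low ++ (p, Cross s') :: high).
Proof.
move=> [hphi maxphi]; split; first exact: coloring_crossing hphi.
move=> psi /coloring_crossing-/(_ s)/maxphi[f hf].
by exists f => k; rewrite (cup_at_crossing _ _ _ s) => /hf.
Qed.

Lemma mixed_crossing_coloring (phi : nat -> bool) low p s high :
  coloring phi (low ++ (p, Cross s) :: high) ->
  phi (label low p) != phi (label low p.+1) -> mixed_crossing low p high.
Proof.
move=> h; apply: contraNneq => e.
have h' : coloring phi (crossed low p high true) by apply: coloring_crossing h.
by rewrite -(coloring_rep _ h') e coloring_rep.
Qed.

Section Delta.
Local Open Scope ring_scope.
Variables (R : realType) (V theta : diagram -> ratfun R).
Hypotheses (HV : is_jones V) (Htheta : is_theta V theta).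
Local Notation q := (qvar R).
Local Notation E := (Evar R).

Lemma qvar_neq0 : q != 0.
Proof. by rewrite /qvar tofrac_eq0 polyC_eq0 polyX_eq0. Qed.

(** Equality up to a power of [q ^+ 4], with a factor on each side so that no negative exponent
    occurs. *)
Definition related (x y : ratfun R) : Prop :=
  exists a b : nat, (q ^+ 4) ^+ a * x = (q ^+ 4) ^+ b * y.

Lemma related_refl x : related x x.
Proof. by exists 0, 0. Qed.

Lemma related_sym x y : related x y -> related y x.
Proof. by move=> [a [b e]]; exists b, a. Qed.

Lemma related_trans x y z : related x y -> related y z -> related x z.
Proof.
move=> [a [b e1]] [c [d e2]]; exists (c + a)%N, (b + d)%N.
by rewrite !exprD -mulrA e1 -mulrA -e2 mulrCA.
Qed.

Definition delta (D : diagram) : ratfun R := V D - theta D.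

Lemma delta_knot D : is_knot D -> delta D = 0.
Proof.
move=> kD; have lD : is_link D by case/andP: kD.
have := theta_split Htheta (Ks := [:: D]) (D := D) isT.
rewrite /= kD /delta => -> //; last by split=> //=; rewrite cats0; apply: rst_refl.
by rewrite subrr expr0z mul1r subrr.
Qed.

Lemma delta_crossing (phi : nat -> bool) low p s s' high :
  bicoloring phi (low ++ (p, Cross s) :: high) ->
  phi (label low p) != phi (label low p.+1) ->
  related (delta (low ++ (p, Cross s) :: high))
          (delta (low ++ (p, Cross s') :: high)).
Proof.
move=> bphi ne; set par := upward low p == upward low p.+1.
(* Comparison with [par] is its own inverse, which turns the shape of a crossing into its sign. *)
have crossedE b : low ++ (p, Cross b) :: high = crossed low p high (b == par).
  by rewrite /crossed -/par; case: b par => -[].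
have links b : is_link (crossed low p high b).
  by apply: (@coloring_is_link _ phi); case: (bicoloring_crossing (b == par) bphi).
have knot := smoothing_knot bphi ne.
have triple : conway_triple low p high (crossed low p high true)
    (crossed low p high false) (smoothed low p high).
  by split=> //; split=> //; case/andP: knot.
have key : delta (crossed low p high true) = q ^+ 4 * delta (crossed low p high false).
  have h1 := jones_skein HV triple.
  have h2 := theta_skein Htheta triple (mixed_crossing_coloring (proj1 bphi) ne).
  have h0 := delta_knot knot; rewrite /skein in h1 h2.
  have : q ^- 2 * delta (crossed low p high true) - q ^+ 2 * delta (crossed low p high false) = 0.
    rewrite -(mulr0 (q - q^-1)) -h0 /delta !mulrBr -h1 -h2; ring.
  move/eqP; rewrite subr_eq0 => /eqP e.
  rewrite -[LHS](mulVKf (expf_neq0 2 qvar_neq0)) e mulrA -exprD.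
  by [].
have kr : related (delta (crossed low p high true)) (delta (crossed low p high false)).
  by exists 0, 1; rewrite expr0 expr1 mul1r.
rewrite !crossedE; case: (_ == par); case: (_ == par) => //; try exact: related_refl.
exact: related_sym.
Qed.

(** The slices already treated are moved into [low], so that each step changes one crossing of a
    complete link for which [phi] is still a bicolouring. *)
Lemma delta_over (phi : nat -> bool) low high st :
  bicoloring phi (low ++ high) -> strands low = Some st ->
  related (delta (low ++ high))
    (delta (low ++ traverse over_slice (fun j => phi (size low + j)%N) high
                            (recolor phi st))).
Proof.
elim: high low st => [|x high IH] low st; first by move=> *; apply: related_refl.
move=> bphi hst.
have [x' [hx' bphi' rel]] : exists x',
    [/\ over_slice (phi (size low + 0)%N) x (recolor phi st) = [:: x'],
        bicoloring phi (low ++ x' :: high)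
      & related (delta (low ++ x :: high)) (delta (low ++ x' :: high))].
  have same : exists x', [/\ [:: x] = [:: x'], bicoloring phi (low ++ x' :: high)
      & related (delta (low ++ x :: high)) (delta (low ++ x' :: high))].
    by exists x; split=> //; apply: related_refl.
  case: x bphi same => p [o||s] bphi same //; rewrite /over_slice /=.
  have [A [u [v [B [stE pE _]]]]] := strands_crossing (proj1 bphi) hst.
  have [su sv] : scol false (recolor phi st) p = phi (label low p) /\
      scol false (recolor phi st) p.+1 = phi (label low p.+1).
    rewrite /label /top_strand hst stE pE /recolor map_cat /=.
    rewrite -(size_map (fun u : strand => (phi u.1, u.2))) scol_cat scol_catS.
    rewrite size_map !nth_cat ltnn subnn ltnNge leqnSn subSnn.
    by [].
  rewrite su sv; case: eqP => [_ //|/eqP ne].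
  exists (p, Cross (phi (label low p))); split=> //.
    exact: bicoloring_crossing bphi.
  exact: delta_crossing bphi ne.
apply: related_trans rel _.
have /coloring_cat[st' [hst' _ _]] : coloring phi (rcons low x' ++ high).
  by rewrite cat_rcons; case: bphi'.
have hlow' : gstep (@anyrel bool) (phi (size low + 0)%N) x (recolor phi st)
    = Some (recolor phi st').
  have -> : gstep (@anyrel bool) (phi (size low + 0)%N) x (recolor phi st)
     = gstep (@anyrel bool) (phi (size low + 0)%N) x' (recolor phi st).
    by case: hx' => <-; case: (x) => p [].
  move: hst'; rewrite strands_grun -cats1 grun_cat -strands_grun hst /=.
  rewrite gstep_recolor -/(anyrel _).
  by case: (gstep _ _ _ _) => //= t [->].
have -> : traverse over_slice (fun j => phi (size low + j)%N) (x :: high) (recolor phi st)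
    = [:: x'] ++ traverse over_slice (fun j => phi (size (rcons low x') + j)%N) high
                   (recolor phi st').
  rewrite -hx' [LHS]/= hlow' /=; congr (_ :: _).
  by apply: eq_traverse => k; rewrite size_rcons addSnnS.
rewrite [[:: x'] ++ _]/= -!cat_rcons in bphi' *.
exact: IH.
Qed.
End Delta.

(** * Isotopies of stacked diagrams and of braid closures *)

Lemma isotopic_is_link A B : isotopic A B -> is_link A = is_link B.
Proof.
elim=> {A B} [_ _ [low high A B _ -> ->]|A|A B _ -> //|A B C _ -> _ ->] //.
Qed.

Lemma isotopic_cat L H A B : is_link L -> is_link H -> isotopic A B ->
  isotopic (L ++ A ++ H) (L ++ B ++ H).
Proof.
move=> lL lH; elim=> {A B} [_ _ [low high A B m lA lB]|A|A B _|A B C _ + _].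
- have links D : is_link (low ++ D ++ high) ->
      is_link ((L ++ low) ++ D ++ high ++ H).
    move=> lD; have -> : (L ++ low) ++ D ++ high ++ H = L ++ (low ++ D ++ high) ++ H.
      by rewrite -!catA.
    exact: is_link_cat lL (is_link_cat lD lH).
  rewrite -!catA !(catA L).
  by apply: rst_step; apply: IsotopyMove => //; apply: links.
- exact: rst_refl.
- exact: rst_sym.
- exact: rst_trans.
Qed.

Lemma red_step low high A B C :
  safe_move A B -> red (low ++ B ++ high) C -> red (low ++ A ++ high) C.
Proof. by move=> m; apply: red_trans; apply: red_move. Qed.

(** Closure of a braid on two strands, one letter per crossing; [trefoil s] is [closure2
    [:: s; s; s]]. *)
Definition closure2 (w : seq bool) : diagram :=
  [:: (0, Cup true); (1, Cup true)] ++ [seq (0, Cross s) | s <- w]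
  ++ [:: (1, Cap); (0, Cap)].

Definition closure3 (w : diagram) : diagram :=
  [:: (0, Cup true); (1, Cup true); (2, Cup true)] ++ w
  ++ [:: (2, Cap); (1, Cap); (0, Cap)].

Lemma closure2_unknot s : red (closure2 [:: s]) unknot.
Proof.
apply: (@red_step [:: (0, Cup true); (1, Cup true)] [:: (0, Cap)]
  [:: (0, Cross s); (1, Cap)] [:: (1, Cross (~~ s)); (0, Cap)]).
  by right; split=> //; have := SlideCap 0 (~~ s); rewrite negbK.
apply: (@red_step [:: (0, Cup true)] [:: (0, Cap); (0, Cap)] _ _ _
  (or_introl (Reidemeister1Cup 1 true (~~ s)))).
apply: (@red_step [:: (0, Cup true)] [:: (0, Cap)] _ _ _
  (or_introl (ZigzagL 0 false))).
exact: red_refl.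
Qed.

Lemma closure2_cancel w s w' : red (closure2 (w ++ [:: s, ~~ s & w'])) (closure2 (w ++ w')).
Proof.
have := @red_move ([:: (0, Cup true); (1, Cup true)] ++ [seq (0, Cross s) | s <- w])
  ([seq (0, Cross s) | s <- w'] ++ [:: (1, Cap); (0, Cap)]) _ _
  (or_introl (Reidemeister2 0 s)).
by rewrite /closure2 !map_cat /= -!catA.
Qed.

(** Markov destabilization: the outer arc meets the rest in a single crossing. Its local minimum and
    maximum are brought next to this crossing, which becomes a curl, and a zigzag remains. *)
Lemma closure3_destabilize w s w' :
  red (closure3 ([seq (0, Cross s) | s <- w] ++ (1, Cross s) :: [seq (0, Cross s) | s <- w']))
      (closure2 (w ++ w')).
Proof.
set W := [seq _ | _ <- w]; set W' := [seq _ | _ <- w'].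
have slideW : red ((2, Cup true) :: W) (W ++ [:: (2, Cup true)]).
  rewrite {}/W; elim: w => [|b w IH] /=; first exact: red_refl.
  apply: (@red_step [::] [seq (0, Cross s) | s <- w]
    [:: (2, Cup true); (0, Cross b)] [:: (0, Cross b); (2, Cup true)]).
    by right; split=> //; apply: (Exchange 0 0 (Cross b) (Cup true)).
  exact: (redd_catl (b := true) [:: _] IH).
have slideW' : red (W' ++ [:: (2, Cap)]) ((2, Cap) :: W').
  rewrite {}/W'; elim: w' => [|b w' IH] /=; first exact: red_refl.
  apply: red_trans (redd_catl (b := true) [:: _] IH) _.
  apply: (@red_step [::] [seq (0, Cross s) | s <- w']
    [:: (0, Cross b); (2, Cap)] [:: (2, Cap); (0, Cross b)]).
    by left; apply: (Exchange 0 0 (Cross b) Cap).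
  exact: red_refl.
have h1 := red_ctx [:: (0, Cup true); (1, Cup true)]
  ((1, Cross s) :: W' ++ [:: (2, Cap); (1, Cap); (0, Cap)]) slideW.
have h2 := red_ctx ([:: (0, Cup true); (1, Cup true)] ++ W ++ [:: (2, Cup true); (1, Cross s)])
  [:: (1, Cap); (0, Cap)] slideW'.
rewrite /closure3 /closure2 map_cat -/W -/W'.
apply: red_trans (_ : red _ (([:: (0, Cup true); (1, Cup true)] ++ W) ++
   [:: (2, Cup true); (1, Cross s); (2, Cap)] ++ W' ++ [:: (1, Cap); (0, Cap)])) _.
  by move: h1 h2; rewrite /= -!catA /=; apply: red_trans.
apply: (@red_step _ ((2, Cap) :: W' ++ [:: (1, Cap); (0, Cap)])
  [:: (2, Cup true); (1, Cross s)] [:: (1, Cup true); (2, Cross (~~ s))]).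
  by right; split=> //; have := SlideCup 1 true (~~ s); rewrite negbK.
have h1' := @red_move ([:: (0, Cup true); (1, Cup true)] ++ W ++ [:: (1, Cup true)])
  (W' ++ [:: (1, Cap); (0, Cap)]) _ _ (or_introl (Reidemeister1Cap 2 (~~ s))).
have h2' := @red_move ([:: (0, Cup true); (1, Cup true)] ++ W)
  (W' ++ [:: (1, Cap); (0, Cap)]) _ _ (or_introl (ZigzagR 1 true)).
by move: h1' h2'; rewrite /= -!catA /=; apply: red_trans.
Qed.

(** The maximum of the circle is raised above [D], which then stands to the right of its two
    strands, and the minimum follows. *)
Lemma red_unknot_comm D : red (unknot ++ D) (D ++ unknot).
Proof.
have h1 := redd_catl (b := true) [:: (0, Cup true)] (redd_comm0 true Cap D).
have h2 := redd_catr (b := true) [:: (0, Cap)] (redd_comm0 true (Cup true) D).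
rewrite /= shift0 -/(shift 2 D) in h1; rewrite /= shift0 -catA in h2.
exact: red_trans h1 h2.
Qed.

(** * Jones polynomials *)

Section SkeinAlgebra.
Local Open Scope ring_scope.
Variables (F : fieldType) (q : F).
Hypotheses (q0 : q != 0) (q2 : q ^+ 2 != 1).
Implicit Types x y z g : F.

Lemma subr_inv_neq0 : q - q^-1 != 0.
Proof.
apply: contra q2; rewrite subr_eq0 => /eqP e.
by rewrite expr2 {2}e divff.
Qed.

(** The case of a curl: both signs give the same value [x], and smoothing splits off a circle,
    whence the factor [- (q + q^-1)]. *)
Lemma skein_smoothed x y z : q ^- 2 * x - q ^+ 2 * y = (q - q^-1) * z ->
  x = y -> z = - (q + q^-1) * x.
Proof.
move=> sk xy; apply: (mulfI subr_inv_neq0); rewrite -sk xy; field; exact: q0.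
Qed.

Lemma skein_positive x y z : q ^- 2 * x - q ^+ 2 * y = (q - q^-1) * z ->
  x = q ^+ 2 * ((q - q^-1) * z + q ^+ 2 * y).
Proof. by move=> <-; field. Qed.

Lemma skein_negative x y z : q ^- 2 * x - q ^+ 2 * y = (q - q^-1) * z ->
  y = q ^- 2 * (q ^- 2 * x - (q - q^-1) * z).
Proof. by move=> <-; field. Qed.

(** [x0], [x2] and [x3] stand for the closures of the braids with 0, 2 and 3 positive crossings
    (unlink, Hopf link, trefoil), and [g] for the closure with one crossing, an unknot. *)
Lemma positive_trefoil_skein x0 x2 x3 g :
  x0 = - (q + q^-1) * g ->
  q ^- 2 * x2 - q ^+ 2 * x0 = (q - q^-1) * g ->
  q ^- 2 * x3 - q ^+ 2 * g = (q - q^-1) * x2 ->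
  x3 = (q ^+ 2 + q ^+ 6 - q ^+ 8) * g /\ x2 = - (q ^+ 5 + q) * g.
Proof.
move=> -> /skein_positive x2E /skein_positive ->; rewrite {}x2E.
by split; field.
Qed.

Lemma negative_trefoil_skein x0 x2 x3 g :
  x0 = - (q + q^-1) * g ->
  q ^- 2 * x0 - q ^+ 2 * x2 = (q - q^-1) * g ->
  q ^- 2 * g - q ^+ 2 * x3 = (q - q^-1) * x2 ->
  x3 = (q ^- 2 + q ^- 6 - q ^- 8) * g.
Proof. by move=> -> /skein_negative -> /skein_negative ->; field. Qed.

Lemma figure_eight_skein x g :
  q ^- 2 * g - q ^+ 2 * x = (q - q^-1) * (- (q ^+ 5 + q) * g) ->
  x = (q ^- 4 + q ^+ 4 + 1 - q ^+ 2 - q ^- 2) * g.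
Proof. by move=> /skein_negative ->; field. Qed.
End SkeinAlgebra.

Section Jones.
Local Open Scope ring_scope.
Variables (R : realType) (V : diagram -> ratfun R).
Hypothesis HV : is_jones V.
Local Notation q := (qvar R).

Let q0 : q != 0 := qvar_neq0 R.

Lemma evaluate_q (P Q : {poly R[i]}) x :
  tofrac P%:P = tofrac Q%:P :> ratfun R -> P.[x] = Q.[x].
Proof. by move/eqP; rewrite tofrac_eq => /eqP/polyC_inj ->. Qed.

Lemma qvarE : q = tofrac ('X : {poly R[i]})%:P. Proof. by []. Qed.

Lemma sqr_qvar_neq (c : R[i]) : c != 0 -> q ^+ 2 != tofrac c%:P%:P.
Proof.
move=> c0; apply/eqP; rewrite qvarE -tofracXn -rmorphXn.
move/(@evaluate_q _ _ 0)/eqP; rewrite hornerXn hornerC expr0n eq_sym.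
by rewrite (negbTE c0).
Qed.

Lemma sqr_qvar_neq1 : q ^+ 2 != 1.
Proof. by rewrite -tofrac1; apply: (@sqr_qvar_neq 1); apply: oner_neq0. Qed.

Lemma qvar_addV_neq0 : q + q^-1 != 0.
Proof.
have: q ^+ 2 != -1.
  rewrite -tofrac1 -tofracN -!polyCN; apply: sqr_qvar_neq.
  by rewrite oppr_eq0 oner_neq0.
by apply: contra; rewrite addr_eq0 => /eqP e; rewrite expr2 {2}e mulrN divff.
Qed.

Let q2 : q ^+ 2 != 1 := sqr_qvar_neq1.

Lemma jones_red A B X : red A B -> is_link A -> is_link X -> V (A ++ X) = V (B ++ X).
Proof.
move=> rAB lA lX; have lAX := is_link_cat lA lX.
have [i lBX] := red_isotopic lAX (red_ctx [::] X rAB).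
exact: (jones_invariant HV lAX lBX i).
Qed.

Lemma jones_skein_cat low p high X :
  is_link (crossed low p high true) -> is_link (smoothed low p high) -> is_link X ->
  q ^- 2 * V (crossed low p high true ++ X) - q ^+ 2 * V (crossed low p high false ++ X)
  = (q - q^-1) * V (smoothed low p high ++ X).
Proof.
move=> l1 l0 lX.
have l2 : is_link (crossed low p high false).
  by move: l1; rewrite !is_linkE /crossed !urun_cat.
apply: (jones_skein HV (low := low) (p := p) (high := high ++ X)).
split; first by rewrite /crossed /smoothed -!catA.
by split; apply: is_link_cat.
Qed.

(** Skein relation at the last letter of the braid. Stacking an arbitrary [X] on top yields factors
    in front of [V (unknot ++ X)], which can be composed for split unions. The value for the Hopf
    link is kept for the figure-eight knot. *)
Lemma jones_closure2 X s : is_link X ->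
  V (trefoil s ++ X) =
  (if s then q ^+ 2 + q ^+ 6 - q ^+ 8 else q ^- 2 + q ^- 6 - q ^- 8) * V (unknot ++ X)
  /\ V (closure2 [:: true; true] ++ X) = - (q ^+ 5 + q) * V (unknot ++ X).
Proof.
move=> lX; pose f w := V (closure2 w ++ X); set g := V (unknot ++ X).
have f1 b : f [:: b] = g by apply: jones_red (closure2_unknot b) _ lX; case: b.
have cancel w b w' : is_link (closure2 (w ++ [:: b, ~~ b & w'])) ->
    f (w ++ [:: b, ~~ b & w']) = f (w ++ w').
  by move=> l; apply: jones_red (closure2_cancel w b w') l lX.
pose cups2 := [:: (0%N, Cup true); (1%N, Cup true)].
pose caps2 := [:: (1%N, Cap); (0%N, Cap)].
have sk0 : q ^- 2 * f [:: true] - q ^+ 2 * f [:: false] = (q - q^-1) * f [::].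
  exact: (@jones_skein_cat cups2 0 caps2).
have sk1t : q ^- 2 * f [:: true; true] - q ^+ 2 * f [:: true; false]
    = (q - q^-1) * f [:: true].
  exact: (@jones_skein_cat (cups2 ++ [:: (0%N, Cross true)]) 0 caps2).
have sk2t : q ^- 2 * f [:: true; true; true] - q ^+ 2 * f [:: true; true; false]
    = (q - q^-1) * f [:: true; true].
  exact: (@jones_skein_cat (cups2 ++ [:: (0%N, Cross true); (0%N, Cross true)]) 0 caps2).
have sk1f : q ^- 2 * f [:: false; true] - q ^+ 2 * f [:: false; false]
    = (q - q^-1) * f [:: false].
  exact: (@jones_skein_cat (cups2 ++ [:: (0%N, Cross false)]) 0 caps2).
have sk2f : q ^- 2 * f [:: false; false; true] - q ^+ 2 * f [:: false; false; false]
    = (q - q^-1) * f [:: false; false].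
  exact: (@jones_skein_cat (cups2 ++ [:: (0%N, Cross false); (0%N, Cross false)]) 0 caps2).
rewrite !f1 in sk0 sk1t sk1f.
rewrite (cancel [::] true [::]) // in sk1t; rewrite (cancel [::] false [::]) // in sk1f.
rewrite (cancel [:: true] true [::]) // f1 in sk2t.
rewrite (cancel [:: false] false [::]) // f1 in sk2f.
have f0E := skein_smoothed q0 q2 sk0 erefl.
have [fttt ftt] := positive_trefoil_skein q0 f0E sk1t sk2t.
have fff := negative_trefoil_skein q0 f0E sk1f sk2f.
by split=> //; case: s.
Qed.

(** At the last crossing, the smoothing destabilizes to the Hopf link and the crossing change gives
    an unknot. *)
Lemma jones_figure_eight X : is_link X ->
  V (figure_eight ++ X) =
  (q ^- 4 + q ^+ 4 + 1 - q ^+ 2 - q ^- 2) * V (unknot ++ X).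
Proof.
move=> lX; set g := V (unknot ++ X).
pose t : slice := (0%N, Cross true).
have sk : q ^- 2 * V (closure3 [:: t; (1%N, Cross false); t; (1%N, Cross true)] ++ X)
    - q ^+ 2 * V (figure_eight ++ X)
    = (q - q^-1) * V (closure3 [:: t; (1%N, Cross false); t] ++ X).
  exact: (@jones_skein_cat [:: (0%N, Cup true); (1%N, Cup true); (2%N, Cup true);
    t; (1%N, Cross false); t] 1 [:: (2%N, Cap); (1%N, Cap); (0%N, Cap)]).
have e0 : V (closure3 [:: t; (1%N, Cross false); t] ++ X) = - (q ^+ 5 + q) * g.
  rewrite -(proj2 (jones_closure2 true lX)).
  exact: jones_red (closure3_destabilize [:: true] false [:: true]) _ lX.
have e1 : V (closure3 [:: t; (1%N, Cross false); t; (1%N, Cross true)] ++ X) = g.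
  apply: jones_red _ _ lX => //.
  (* The braid relation turns sigma_2^-1 sigma_1 sigma_2 into sigma_1 sigma_2 sigma_1^-1, which
     leaves a single sigma_2 to destabilize. *)
  apply: (@red_step [:: (0%N, Cup true); (1%N, Cup true); (2%N, Cup true); t]
     [:: (2%N, Cap); (1%N, Cap); (0%N, Cap)]
     [:: (1%N, Cross false); t; (1%N, Cross true)]
     [:: t; (1%N, Cross true); (0%N, Cross false)]).
    by right; split=> //; apply: (@Reidemeister3 0 true true false).
  apply: red_trans (closure3_destabilize [:: true; true] true [:: false]) _.
  apply: red_trans (closure2_cancel [:: true] true [::]) _.
  exact: closure2_unknot.
rewrite e0 e1 in sk; exact (figure_eight_skein q0 sk).
Qed.

Lemma jones_unlink2 : V unlink2 = - (q + q^-1).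
Proof.
have e b : V [:: (0%N, Cup true); (0%N, Cross b); (0%N, Cap)] = 1.
  rewrite -(jones_unknot HV) -[RHS](congr1 V (cats0 _)).
  apply: (@jones_red [:: (0%N, Cup true); (0%N, Cross b); (0%N, Cap)] unknot [::]) => //.
    apply: (@red_step [:: (0%N, Cup true)] [::] _ _ _ (or_introl (Reidemeister1Cap 0 b))).
    exact: red_refl.
have := @jones_skein_cat [:: (0%N, Cup true)] 0 [:: (0%N, Cap)] [::] isT isT isT.
rewrite [crossed _ _ _ true ++ _]/= [crossed _ _ _ false ++ _]/= !e.
rewrite [V (smoothed _ _ _ ++ _)](_ : _ = V (unlink2 ++ [::])).
  by rewrite cats0 => sk; rewrite (skein_smoothed q0 q2 sk erefl) mulr1.
apply: jones_red => //.
(* The smoothing directs the second circle the other way; adding a curl at its minimum and removing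
   it at its maximum restores the direction used in [unlink2]. *)
apply: (@red_step [:: (0%N, Cup true); (0%N, Cap)] [:: (0%N, Cap)]
  [:: (0%N, Cup false)] [:: (0%N, Cup true); (0%N, Cross true)]).
  by right; split=> //; apply: (Reidemeister1Cup 0 true true).
apply: (@red_step [:: (0%N, Cup true); (0%N, Cap); (0%N, Cup true)] [::] _ _ _
  (or_introl (Reidemeister1Cap 0 true))).
exact: red_refl.
Qed.

Lemma jones_trefoil_figure_eight s :
  V (trefoil s ++ figure_eight) =
  (if s then q ^+ 2 + q ^+ 6 - q ^+ 8 else q ^- 2 + q ^- 6 - q ^- 8)
  * (q ^- 4 + q ^+ 4 + 1 - q ^+ 2 - q ^- 2) * V unlink2.
Proof.
have [-> _] := @jones_closure2 figure_eight s isT.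
have := jones_red (red_unknot_comm figure_eight) isT (isT : is_link [::]).
by rewrite !cats0 => ->; rewrite jones_figure_eight // mulrA.
Qed.
End Jones.

(** * Evaluation at a square root of -1, and the conclusion *)

(** With the standard diagrams in place of the components, being a knot is checked by computation
    and the Jones polynomial is known. *)
Lemma trefoil_figure_eight_split_isotopic (D K1 K2 : diagram) :
  is_link D -> isotopic D (K1 ++ K2) -> is_trefoil K1 -> is_figure_eight K2 ->
  exists s, isotopic D (trefoil s ++ figure_eight).
Proof.
move=> lD iD [s i1] i2; exists s.
have l1 : is_link K1 by rewrite (isotopic_is_link i1); case: (s).
have l2 : is_link K2 by rewrite (isotopic_is_link i2).
apply: rst_trans iD _; apply: (@rst_trans _ _ _ (trefoil s ++ K2)).
  exact: (@isotopic_cat [::] K2 _ _ isT l2 i1).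
have := @isotopic_cat (trefoil s) [::] _ _ _ isT i2; rewrite !cats0; apply.
by case: (s).
Qed.

(* Specializing [x] to a square root of -1 turns the factors coming from the
   trefoil and the figure-eight knot into -3 and 5, up to powers of [x ^+ 4]. *)
Lemma trefoil_figure_eight_specialization (A K : comNzRingType) (F : fieldType)
    (f : {rmorphism A -> F}) (g : {rmorphism A -> K}) (x : A)
    (s : bool) (a b : nat) (q := f x) :
  (injective f -> q != 0 -> g x ^+ 2 = -1 ->
  (q ^+ 4) ^+ a = (q ^+ 4) ^+ b *
    ((if s then q ^+ 2 + q ^+ 6 - q ^+ 8 else q ^- 2 + q ^- 6 - q ^- 8)
     * (q ^- 4 + q ^+ 4 + 1 - q ^+ 2 - q ^- 2)) ->
  16%:R = 0 :> K)%R.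
Proof.
move=> injf q0 gx e.
(* The factor [x ^+ 12] clears the denominators: degree 8 from the left-handed trefoil and degree 4
   from the figure-eight knot. Injectivity of [f] then brings the identity back to [A], where [g]
   applies. *)
have: f (x ^+ 12 * (x ^+ 4) ^+ a)%R = f ((x ^+ 4) ^+ b *
    ((if s then x ^+ 10 + x ^+ 14 - x ^+ 16 else x ^+ 6 + x ^+ 2 - 1)
     * (1 + x ^+ 8 + x ^+ 4 - x ^+ 6 - x ^+ 2)))%R.
  rewrite rmorphM !rmorphXn -/q {}e.
  by case: s; rewrite !(rmorphM, rmorphB, rmorphD, rmorphXn, rmorph1) -/q; field.
move/injf/(congr1 g); rewrite 2!rmorphM !rmorphXn.
have gX n : (g x ^+ n.*2 = (-1) ^+ n)%R by rewrite -mul2n exprM gx.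
rewrite (gX 2) (gX 6) !sqrrN !expr1n => e'.
transitivity (1 - - 15%:R : K)%R; first by ring.
move: e'; rewrite (_ : (-1) ^+ 6 = 1 :> K)%R; last by ring.
rewrite !mul1r => {1}->.
rewrite rmorphM; case: s {e};
  rewrite !(rmorphB, rmorphD, rmorphXn, rmorph1);
  by rewrite ?(gX 1) ?(gX 2) ?(gX 3) ?(gX 4) ?(gX 5) ?(gX 7) ?(gX 8); ring.
Qed.

Section Evaluation.
Local Open Scope ring_scope.
Variable R : realType.
Local Notation q := (qvar R).

Lemma trefoil_figure_eight_polynomial (s : bool) (a b : nat) :
  (q ^+ 4) ^+ a <> (q ^+ 4) ^+ b *
    ((if s then q ^+ 2 + q ^+ 6 - q ^+ 8 else q ^- 2 + q ^- 6 - q ^- 8)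
     * (q ^- 4 + q ^+ 4 + 1 - q ^+ 2 - q ^- 2)).
Proof.
move=> e; have injf : injective (@tofrac {poly {poly R[i]}} \o polyC).
  by move=> P Q /eqP; rewrite /= tofrac_eq => /eqP/polyC_inj.
have sqri : (horner_eval ('i%C : R[i]) 'X) ^+ 2 = -1.
  by rewrite /horner_eval hornerX sqr_i.
have := trefoil_figure_eight_specialization injf (qvar_neq0 R) sqri e.
by apply/eqP; rewrite Num.Theory.pnatr_eq0.
Qed.
End Evaluation.

Local Open Scope ring_scope.

Lemma coloring_split_isotopic (phi : nat -> bool) T (P1 P2 : pred nat) :
  coloring phi T ->
  (forall k, cup_at T k -> P1 k = phi k) -> (forall k, cup_at T k -> P2 k = ~~ phi k) ->
  is_link (traverse over_slice phi T [::]) /\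
  isotopic (traverse over_slice phi T [::]) (sublink P1 T ++ sublink P2 T).
Proof.
move=> hphi h1 h2.
rewrite (sublink_coloring (b := true) hphi); last by move=> k /h1 ->; rewrite eqb_id.
rewrite (sublink_coloring (b := false) hphi); last by move=> k /h2 ->; rewrite eqbF_neg.
exact: two_coloring_split.
Qed.

Lemma theta_two_knots (R : realType) (V theta : diagram -> ratfun R) D K1 K2 :
  is_theta V theta -> is_knot K1 -> is_knot K2 -> split_union D [:: K1; K2] ->
  theta D = (Evar R)^-1 * V D.
Proof.
move=> Htheta k1 k2 split.
by rewrite (theta_split Htheta (Ks := [:: K1; K2]) _ _ split) //= k1 k2.
Qed.

Lemma Evar_neq1 (R : realType) : Evar R != 1.
Proof.
rewrite /Evar -tofrac1 tofrac_eq; apply/eqP => /(congr1 (fun p : {poly {poly R[i]}} => p.[0])).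
by rewrite hornerX hornerC => /esym/eqP; rewrite oner_eq0.
Qed.

(** [e] stands for [E^-1], [u] for the value of [V] on the unlink and [p] for the product of the two
    Jones polynomials: both differences contain the nonzero factor [(1 - e) * u]. *)
Lemma cancel_delta (F : fieldType) (x y p e u : F) :
  e != 1 -> u != 0 ->
  x * (u - e * u) = y * (p * u - e * (p * u)) -> x = y * p.
Proof.
move=> e1 u0 eq_delta; have nz : (1 - e) * u != 0.
  by rewrite mulf_neq0 // subr_eq0 eq_sym.
apply: (mulIf nz); transitivity (x * (u - e * u)); first by ring.
by rewrite eq_delta; ring.
Qed.

Theorem mainTheorem4 (R : realType) (V theta : diagram -> ratfun R)
    (HV : is_jones V) (Htheta : is_theta V theta)
    (T : diagram) (c1 c2 : nat)
    (T_link : is_link T)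
    (T_components : perm_eq (components T) [:: c1; c2])
    (T_trefoil : is_trefoil (component T c1))
    (T_figure_eight : is_figure_eight (component T c2))
    (T_jones : V T = - (qvar R + (qvar R)^-1)) :
  theta T <> theta unlink2.
Proof.
move=> theta_eq; set phi := fun a => rep T a == c1.
have [bphi hc2] := two_components_bicoloring T_link T_components.
have [lD iD] := coloring_split_isotopic (P1 := [pred a | rep T a == c1])
  (P2 := [pred a | rep T a == c2]) (proj1 bphi) (fun _ _ => erefl) hc2.
have [s iDs] := trefoil_figure_eight_split_isotopic lD iD T_trefoil T_figure_eight.
have := @delta_over R V theta HV Htheta phi [::] T [::] bphi erefl.
set D := traverse over_slice phi T [::] in lD iD iDs *.
change (related (delta V theta T) (delta V theta D) -> False); rewrite /delta theta_eq.
have thetaU : theta unlink2 = (Evar R)^-1 * V unlink2.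
  by apply: (theta_two_knots (K1 := unknot) (K2 := unknot) Htheta) => //; split=> //;
    apply: rst_refl.
have thetaD : theta D = (Evar R)^-1 * V D.
  by apply: (theta_two_knots (K1 := trefoil s) (K2 := figure_eight) Htheta).
have VU := jones_unlink2 HV.
have VD : V D = V (trefoil s ++ figure_eight).
  by apply: (jones_invariant HV lD _ iDs); rewrite -(isotopic_is_link iDs).
rewrite thetaU thetaD T_jones -VU VD (jones_trefoil_figure_eight HV) => -[a [b e]].
apply: (@trefoil_figure_eight_polynomial R s a b).
apply: cancel_delta e; last by rewrite VU oppr_eq0 qvar_addV_neq0.
by rewrite invr_eq1 Evar_neq1.
Qed.
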